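(* Let $k\in\mathbb N$, $r\in\mathbb N_0$, $1\le p\le\infty$, and let $\alpha,\beta\in\mathbb R$ satisfy $r/2+\alpha\ge0$ and $r/2+\beta\ge0$. If $f\in\mathbb B^r_p(w_{\alpha,\beta})$, then, for some $t_0>0$ independent of $f$ and $t$, $$\omega_{k,r}^\varphi(f^{(r)},t)_{\alpha,\beta,p}\sim\omega^k_\varphi(f^{(r)},t)_{w_{\alpha,\beta}\varphi^r,p},\qquad 0<t\le t_0,$$ where $a(t)\sim b(t)$ means $c_0^{-1}a(t)\le b(t)\le c_0a(t)$ for all such $t$, with a constant $c_0>0$ depending only on $k,r,p,\alpha,\beta$.
   Context: Notation. $\mathbb N_0=\mathbb N\cup\{0\}$. For a measurable set $I\subseteq[-1,1]$ and measurable $f$, $\|f\|_{L_p(I)}=(\int_I|f|^p\,dx)^{1/p}$ for $p<\infty$ and $\|f\|_{L_\infty(I)}=\operatorname{ess\,sup}_{I}|f|$; $\|\cdot\|_p=\|\cdot\|_{L_p[-1,1]}$. For a weight $w$, $L_{w,p}=\{f:\|wf\|_p<\infty\}$. $\varphi(x)=\sqrt{1-x^2}$. $w_{\alpha,\beta}(x)=(1-x)^\alpha(1+x)^\beta$. Spaces: $\mathbb B^0_p(w)=L_{w,p}$ and, for $r\ge1$, $\mathbb B^r_p(w)=\{f: f^{(r-1)}\in AC_{loc}(-1,1)\text{ and }\varphi^rf^{(r)}\in L_{w,p}\}$, where $AC_{loc}(-1,1)$ is the set of functions locally absolutely continuous in $(-1,1)$. Differences: $\Delta_h^k(f,x)=\sum_{i=0}^k\binom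 ki(-1)^{k-i}f(x-\frac{kh}2+ih)$ if $[x-\frac{kh}2,x+\frac{kh}2]\subseteq[-1,1]$, and $\Delta_h^k(f,x)=0$ otherwise. Forward and backward differences: $\overrightarrow{\Delta}_h^k(f,x)=\Delta_h^k(f,x+kh/2)$, $\overleftarrow{\Delta}_h^k(f,x)=\Delta_h^k(f,x-kh/2)$. Weights and domains: $\mathcal W_\delta^{\xi,\zeta}(x)=(1-x-\delta\varphi(x)/2)^\xi(1+x-\delta\varphi(x)/2)^\zeta$; for $\delta>0$, $\mathfrak D_\delta=\{x: 1-\delta\varphi(x)/2\ge|x|\}\setminus\{\pm1\}=\{x:|x|\le\frac{4-\delta^2}{4+\delta^2}\}$ (empty if $\delta>2$). Modulus: for $f\in\mathbb B^r_p(w_{\alpha,\beta})$, $$\omega_{k,r}^\varphi(f^{(r)},t)_{\alpha,\beta,p}=\sup_{0<h\le t}\big\|\mathcal W_{kh}^{r/2+\alpha,r/2+\beta}(\cdot)\,\Delta^k_{h\varphi(\cdot)}(f^{(r)},\cdot)\big\|_{L_p(\mathfrak D_{kh})}.$$ Weighted Ditzian–Totik modulus: for $g\in L_{w,p}$ and with $t^*=2k^2t^2$, $$\omega_\varphi^k(g,t)_{w,p}=\sup_{0<h\le t}\|w(\cdot)\Delta^k_{h\varphi(\cdot)}(g,\cdot)\|_{L_p[-1+t^*,1-t^*]}+\sup_{0<h\le t^*}\|w(\cdot)\overrightarrow{\Delta}^k_h(g,\cdot)\|_{L_p[-1,-1+12t^*]}+\sup_{0<h\le t^*}\|w(\cdot)\overleftarrow{\Delta}^k_h(g,\cdot)\|_{L_p[1-12t^*,1]}.$$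 *)

(* Defs.v *)
From HB Require Import structures.
From mathcomp Require Export all_boot all_order all_algebra.
From mathcomp Require Export all_classical all_reals all_analysis.

Set Implicit Arguments.
Unset Strict Implicit.
Unset Printing Implicit Defensive.

Import Order.TTheory GRing.Theory Num.Theory.
Import numFieldNormedType.Exports.

Local Open Scope classical_set_scope.
Local Open Scope ring_scope.

(* All functions on [-1,1] are total functions R -> R; no value outside
   [-1,1] matters below. In particular derive1n r f may depend on the extension
   of f only at the endpoints, which form a null set. *)

(* R with the Lebesgue (Caratheodory) sigma-algebra, on which
   completed_lebesgue_measure is defined; R itself carries the Borel one. *)
Notation lebesgueR R := (caratheodory_type ((wlength (@idfun R))^*)%mu).

(* ||f||_{L_p(I)}; p = +oo gives the essential supremum. *)
Definition LpI (R : realType) (p : \bar R) (I : set R) (f : R -> R) : \bar R :=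
  Lnorm (@completed_lebesgue_measure R) p
    (fun x : lebesgueR R => ((f \_ I) x)%:E).

Definition Lwp (R : realType) (p : \bar R) (w f : R -> R) : Prop :=
  let I : set R := `[-1, 1]%classic in
  measurable_fun (I : set (lebesgueR R)) (f : lebesgueR R -> R) /\
  (LpI p I (fun x => (w x * f x)%R) < +oo)%E.

Definition phi (R : realType) (x : R) : R := Num.sqrt (1 - x ^+ 2).

Definition jacobi (R : realType) (alpha beta x : R) : R :=
  (1 - x) `^ alpha * (1 + x) `^ beta.

(* The weight w_{alpha,beta} phi^r. *)
Definition jacobi_phi (R : realType) (alpha beta : R) (r : nat) (x : R) : R :=
  jacobi alpha beta x * phi x ^+ r.

Definition abs_cont (R : realType) (a b : R) (f : R -> R) : Prop :=
  forall e : R, 0 < e -> exists2 d : R, 0 < d &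
    forall (n : nat) (u v : 'I_n -> R),
      (forall i, [/\ a <= u i, u i <= v i & v i <= b]) ->
      trivIset [set: 'I_n] (fun i => `]u i, v i[%classic) ->
      \sum_(i < n) (v i - u i) < d ->
      \sum_(i < n) `|f (v i) - f (u i)| < e.

Definition AC_loc (R : realType) (f : R -> R) : Prop :=
  forall a b : R, -1 < a -> a <= b -> b < 1 -> abs_cont a b f.

(* For r = s.+1, membership requires the classical derivatives of order
   1, .., s to exist on ]-1, 1[ (otherwise derive1n s f takes default values).
   Absolute continuity then makes derive1n s.+1 f a true derivative almost
   everywhere on ]-1, 1[. *)
Definition Brp (R : realType) (r : nat) (p : \bar R) (w f : R -> R) : Prop :=
  match r with
  | 0 => Lwp p w f
  | s.+1 =>
      [/\ forall (i : nat) (x : R), (i < s)%N -> -1 < x < 1 ->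
            derivable (derive1n i f) x 1,
          AC_loc (derive1n s f) &
          Lwp p w (fun x => phi x ^+ s.+1 * derive1n s.+1 f x)]
  end.

Definition Delta (R : realType) (k : nat) (h : R) (f : R -> R) (x : R) : R :=
  if `[< `[x - k%:R * h / 2, x + k%:R * h / 2] `<=` `[-1, 1] >] then
    \sum_(0 <= i < k.+1)
      'C(k, i)%:R * (-1) ^+ (k - i) * f (x - k%:R * h / 2 + i%:R * h)
  else 0.

Definition fDelta (R : realType) (k : nat) (h : R) (f : R -> R) (x : R) : R :=
  Delta k h f (x + k%:R * h / 2).

Definition bDelta (R : realType) (k : nat) (h : R) (f : R -> R) (x : R) : R :=
  Delta k h f (x - k%:R * h / 2).

Definition Wdelta (R : realType) (delta xi zeta x : R) : R :=
  (1 - x - delta * phi x / 2) `^ xi * (1 + x - delta * phi x / 2) `^ zeta.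

Definition Ddelta (R : realType) (delta : R) : set R :=
  [set x | `|x| <= 1 - delta * phi x / 2] `\` [set -1; 1].

(* omega_{k,r}^phi(g, t)_{alpha,beta,p}, where g stands for f^(r). *)
Definition omega_kr (R : realType) (k r : nat) (alpha beta : R) (p : \bar R)
    (g : R -> R) (t : R) : \bar R :=
  ereal_sup [set LpI p (Ddelta (k%:R * h))
    (fun x => Wdelta (k%:R * h) (r%:R / 2 + alpha) (r%:R / 2 + beta) x
              * Delta k (h * phi x) g x) | h in `]0, t]].

(* The weighted Ditzian-Totik modulus omega_phi^k(g, t)_{w,p}. *)
Definition omega_DT (R : realType) (k : nat) (w : R -> R) (p : \bar R)
    (g : R -> R) (t : R) : \bar R :=
  let ts := 2 * k%:R ^+ 2 * t ^+ 2 in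
  let main := ereal_sup [set LpI p `[-1 + ts, 1 - ts]
    (fun x => w x * Delta k (h * phi x) g x) | h in `]0, t]] in
  let left := ereal_sup [set LpI p `[-1, -1 + 12 * ts]
    (fun x => w x * fDelta k h g x) | h in `]0, ts]] in
  let right := ereal_sup [set LpI p `[1 - 12 * ts, 1]
    (fun x => w x * bDelta k h g x) | h in `]0, ts]] in
  (main + left + right)%E.

(* Main.v *)
From mathcomp Require Import ring lra.
From mathcomp Require Import measurable_realfun ess_sup_inf.
Require Import Defs.

Set Implicit Arguments.
Unset Strict Implicit.
Unset Printing Implicit Defensive.

Import Order.TTheory GRing.Theory Num.Theory.
Import numFieldNormedType.Exports.
Local Open Scope classical_set_scope.
Local Open Scope ring_scope.

(** Put [a = r/2 + alpha] and [b = r/2 + beta], both nonnegative.  Of [g = f^(r)]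
    only the measurability matters, and both moduli measure its differences with
    the weight [(1 - x)^a (1 + x)^b] or a perturbation of it.  At distance at least
    [2 k^2 t^2] from the endpoints the two weights are comparable for each fixed
    step [h], so everything happens near [-1] and [1], where steps [h phi x] must be
    compared with constant steps.  This rests on the identity, valid for every
    [sigma] ([D_s] being the [k]-th forward difference with step [s]),
      [D_eta(y) = sum_(1 <= i <= k) (-1)^i C(k,i)
                    (D_(i sigma)(y + i eta) - D_(eta + i sigma)(y))].
    Averaging over [sigma] in an interval of length of order [t^2], Tonelli and
    changes of variables bound a difference at [y] by a double integral of
    differences over all steps [tau] up to order [t^2] and all base points near the
    endpoint.  That double integral is controlled by the constant-step modulus
    (freeze [tau]) and by the variable-step modulus (substitute [tau = h phi x],
    where [h <= t] is automatic).  The weight of [omega_kr] is the weight taken at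
    the extreme node of the difference, so monotonicity of [u |-> u^a] suffices.

    To treat [p < oo] and [p = oo] at once, and without Minkowski's inequality, the
    estimates are proved for the integrals of [Phi |.|] with [Phi] nondecreasing:
    [Phi y = y^p], or the indicator of [y > B].  Measurability problems disappear
    after replacing [g] by a Borel function: the node maps are expanding, so
    preimages of null sets are null. *)

(** * Expanding changes of variable *)

Section Expanding.
Variable R : realType.
Local Notation mu := (@lebesgue_measure R).
Implicit Types (X Y A : set R) (psi : R -> R).

(** A lower Lipschitz bound in place of a Jacobian: it yields both a change-of-variable inequality
    and null preimages of null sets. *)
Definition expanding (m : R) X psi :=
  forall x x', X x -> X x' -> m * `|x - x'| <= `|psi x - psi x'|.

(** Such a set lies in [[inf X, inf X + d]]. *)
Lemma lebesgue_measure_bounded_diam X (d : R) : 0 <= d -> measurable X ->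
  (forall x x', X x -> X x' -> `|x - x'| <= d) -> (mu X <= d%:E)%E.
Proof.
move=> d0 mX dX; have [->|/set0P[x0 Xx0]] := eqVneq X set0.
  by rewrite measure0 lee_fin.
have lbX x : X x -> lbound X (x - d).
  by move=> Xx y Xy; have := dX _ _ Xx Xy; rewrite ler_norml; lra.
have iX : has_inf X by split; [exists x0|exists (x0 - d); exact: lbX].
have sX : X `<=` `[inf X, inf X + d]%classic.
  move=> x Xx /=; rewrite in_itv/=; apply/andP; split.
    by apply: ge_inf => //; case: iX.
  by rewrite -lerBlDr; apply: lb_le_inf; [exists x0|exact: lbX].
have mI : measurable (`[inf X, inf X + d]%classic : set R).
  exact: measurable_itv.
apply: (le_trans (le_measure mu _ _ sX)); rewrite ?inE//.
rewrite [leLHS]lebesgue_measure_itv/= lte_fin ltrDl; case: ifP => // _.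
by rewrite -EFinD lee_fin; lra.
Qed.

(** Lebesgue measure is the infimum of total lengths of countable covers by half-open intervals, and
    the points of [X] sent into an interval of length [l] form a set of diameter at most [l / m]. *)
Lemma lebesgue_measure_expanding_preimage m X psi A : 0 < m ->
  measurable X -> measurable_fun setT psi -> expanding m X psi ->
  measurable A -> (mu (X `&` psi @^-1` A) <= m^-1%:E * mu A)%E.
Proof.
move=> m0 mX mpsi ex mA.
have mpre B : measurable B -> measurable (X `&` psi @^-1` B).
  by move=> mB; apply: measurableI => //; rewrite -[_ @^-1` _]setTI; exact: mpsi.
rewrite muleC lee_pdivlMr// [leRHS]/lebesgue_measure/= /lebesgue_stieltjes_measure.
rewrite /measure_extension/= /mu_ext.
apply: le_ereal_inf_tmp => _ [B [mB AB] <-].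
have mB' k : measurable (B k : set R) by apply: sub_sigma_algebra; exact: mB.
have lenB k : (mu (X `&` psi @^-1` B k) * m%:E <= wlength idfun (B k))%E.
  have [[a b] _ abB] := mB k.
  have -> : wlength idfun (B k) = mu (B k).
    rewrite /lebesgue_measure/= /lebesgue_stieltjes_measure /measure_extension/=.
    by rewrite measurable_mu_extE//; exact: mB.
  rewrite -abB lebesgue_measure_itv/= lte_fin -EFinD -lee_pdivlMr//.
  case: ifPn => [ab|].
    rewrite -EFinM; apply: lebesgue_measure_bounded_diam.
    - by apply: divr_ge0; [rewrite subr_ge0 ltW|exact: ltW].
    - by apply: mpre; exact: measurable_itv.
    move=> x x' [Xx /= pab] [Xx' /= pab'].
    rewrite ler_pdivlMr// mulrC (le_trans (ex _ _ Xx Xx'))//.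
    by move: pab pab'; rewrite !in_itv/= ler_norml; lra.
  rewrite -leNgt => ba; rewrite set_itv_ge ?bnd_simp -?leNgt//.
  by rewrite preimage_set0 setI0 measure0 mul0e.
rewrite (@le_trans _ _ (\sum_(k <oo) mu (X `&` psi @^-1` B k) * m%:E))%E//;
  last by apply: lee_nneseries => // k _; rewrite mule_ge0// lee_fin ltW.
have -> : (\sum_(k <oo) mu (X `&` psi @^-1` B k) * m%:E =
    (\sum_(k <oo) mu (X `&` psi @^-1` B k)) * m%:E)%E.
  by rewrite muleC -nneseriesZl//; apply: eq_eseriesr => k _; rewrite muleC.
rewrite lee_pmul2r//.
apply: (@measure_sigma_subadditive _ _ _ mu _ (fun k => X `&` psi @^-1` B k)).
- by move=> k; exact: mpre.
- exact: mpre.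
by rewrite -setI_bigcupr -preimage_bigcup; apply: setIS; apply: preimage_subset.
Qed.

(** By the previous bound, the push-forward under [psi] of Lebesgue measure on [X] is dominated by
    [m^-1] times Lebesgue measure; integrating [F \_ Y] against both replaces the substitution
    rule. *)
Lemma ge0_integral_expanding (m : R) X Y psi (F : R -> \bar R) : 0 < m ->
  measurable X -> measurable Y -> measurable_fun setT psi -> expanding m X psi ->
  (forall x, X x -> Y (psi x)) ->
  measurable_fun setT F -> (forall y, 0 <= F y)%E ->
  (\int[mu]_(x in X) F (psi x) <= m^-1%:E * \int[mu]_(y in Y) F y)%E.
Proof.
move=> m0 mX mY mpsi ex XY mF F0.
have m0' : 0 <= m^-1 by rewrite invr_ge0 ltW.
have mFY : measurable_fun setT (F \_ Y).
  by apply/(measurable_restrictT _ mY); exact: measurable_funTS.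
pose nu := pushforward (mrestr mu mX) (psi : R -> measurableTypeR R).
have FY0 y : (0 <= (F \_ Y) y)%E by rewrite patchE; case: ifP.
rewrite (@le_trans _ _ (\int[nu]_y (F \_ Y) y)%E)//.
  rewrite ge0_integral_pushforward// preimage_setT.
  rewrite (@eq_integral _ _ _ mu X ((F \_ Y) \o psi)); last first.
    by move=> x; rewrite inE => Xx; rewrite /= patchE mem_set//; exact: XY.
  rewrite (_ : (\int[mu]_(x in X) ((F \_ Y) \o psi) x =
      \int[mrestr mu mX]_(x in X) ((F \_ Y) \o psi) x)%E); last first.
    by apply: eq_measure_integral => A mA AX; rewrite /= /mrestr setIidl.
  apply: ge0_subset_integral => //.
    by apply: measurableT_comp.
  by move=> x _; exact: FY0.
pose c := NngNum m0'.
have -> : (m^-1%:E * \int[mu]_(y in Y) F y = \int[mscale c mu]_y (F \_ Y) y)%E.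
  rewrite (@ge0_integral_mscale _ _ _ mu setT measurableT c _ mFY); last first.
    by move=> y _; exact: FY0.
  rewrite [X in (_ = _ * X)%E](_ : _ = \int[mu]_(y in Y) F y)%E//.
  exact/esym/integral_mkcond.
apply: ge0_le_measure_integral => // A mA.
have := lebesgue_measure_expanding_preimage m0 mX mpsi ex mA.
by rewrite setIC.
Qed.

Lemma ge0_le_integral_expanding X Y psi (F F' : R -> \bar R) :
  measurable X -> measurable Y -> measurable_fun setT psi -> expanding 1 X psi ->
  (forall x, X x -> Y (psi x)) ->
  measurable_fun setT F -> (forall y, 0 <= F y)%E ->
  measurable_fun setT F' -> (forall x, 0 <= F' x)%E ->
  (forall x, X x -> F' x <= F (psi x))%E ->
  (\int[mu]_(x in X) F' x <= \int[mu]_(y in Y) F y)%E.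
Proof.
move=> mX mY mpsi ex XY mF F0 mF' F'0 F'F.
apply: (@le_trans _ _ (\int[mu]_(x in X) F (psi x))%E).
  apply: ge0_le_integral => //; first exact: measurable_funTS.
  by apply: measurable_funTS; exact: (measurableT_comp mF mpsi).
have := ge0_integral_expanding (m := 1) ltr01 mX mY mpsi ex XY mF F0.
by rewrite invr1 mul1e.
Qed.

End Expanding.

(** * Borel representatives and [LpI] *)

Section Completion.
Variable R : realType.
Local Notation mu := (@lebesgue_measure R).
Local Notation cmu := (@completed_lebesgue_measure R).
Implicit Types (I N : set R) (f g : R -> R) (p : \bar R).

(** The Caratheodory sigma-algebra is the completion of the Borel one. *)
Lemma lebesgue_measurable_decomp (E : set (lebesgueR R)) : measurable E ->
  exists2 A : set R, measurable A & exists2 N : set R, mu.-negligible N & A `|` N = E.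
Proof.
have := @completed_caratheodory_measurable R.
rewrite g_sigma_completed_algebra_genE => eqC.
move=> mE; have : completed_algebra_gen mu E by rewrite eqC; exact: mE.
by case=> A mA [N nN AN]; exists A => //; exists N.
Qed.

(** Each set where [g] exceeds a given rational is Borel up to a negligible set. Countably many
    negligible sets fit into one Borel null set [N], off which every superlevel set of [g] is a
    countable union of the Borel parts. *)
Lemma borel_representative I (g : lebesgueR R -> R) : measurable I ->
  measurable_fun (I : set (lebesgueR R)) g ->
  exists N, [/\ measurable N, mu N = 0 & measurable_fun setT ((g : R -> R) \_ (I `\` N))].
Proof.
move=> mI mg.
(* An enumeration of the rationals; codes of no rational are sent to 0. *)
pose q (n : nat) : R := ratr (odflt 0 (unpickle n : option rat)).
have mIl : measurable (I : set (lebesgueR R)) by exact: sub_caratheodory.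
have decomp n : exists AN : set R * set R,
    [/\ measurable AN.1, mu.-negligible AN.2 &
      AN.1 `|` AN.2 = I `&` g @^-1` `]q n, +oo[%classic].
  have mE : measurable (I `&` g @^-1` `]q n, +oo[%classic : set (lebesgueR R)).
    by apply: mg => //; exact: measurable_itv.
  have [A mA [N nN AN]] := lebesgue_measurable_decomp mE.
  by exists (A, N).
have [AN ANP] := choice decomp.
have [N [mN N0 subN]] : mu.-negligible (\bigcup_n (AN n).2).
  by apply: negligible_bigcup => n; have [] := ANP n.
exists N; split => //.
have mIN : measurable (I `\` N) by exact: measurableD.
apply: (measurability _ (RGenOInfty.measurableE R)) => //.
move=> _ [_ [y ->] <-]; rewrite setTI.
rewrite (_ : _ @^-1` _ = ((I `\` N) `&` \bigcup_(n in [set n | y < q n]) (AN n).1)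
   `|` (~` (I `\` N) `&` [set x | y < 0])).
  apply: measurableU.
    apply: measurableI => //; apply: bigcup_measurable => n _.
    by have [] := ANP n.
  apply: measurableI; first exact: measurableC.
  have [y0|y0] := pselect (y < 0).
    by rewrite (_ : [set _ | _] = setT)//; apply/seteqP; split.
  by rewrite (_ : [set _ | _] = set0)//; apply/seteqP; split.
apply/seteqP; split=> x /=.
- rewrite in_itv/= andbT patchE; case: ifPn => [|/negP].
    rewrite inE => INx ygx; left; split=> //.
    have [r] := rat_in_itvoo ygx; rewrite in_itv/= => /andP[yr rg].
    have qr : q (pickle r) = ratr r by rewrite /q pickleK.
    exists (pickle r); first by rewrite /= qr.
    have [_ _ E] := ANP (pickle r).
    have : (I `&` g @^-1` `]q (pickle r), +oo[%classic) x.
      by split; [case: INx|rewrite /= in_itv/= qr rg].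
    rewrite -E => -[//|A2x]; exfalso; case: INx => _; apply; apply: subN.
    by exists (pickle r).
  by rewrite inE => INx y0; right.
- move=> [[INx [n /= yq Ax]]|[INx y0]]; rewrite in_itv/= andbT patchE.
    rewrite mem_set//; have [_ _ E] := ANP n.
    have : (I `&` g @^-1` `]q n, +oo[%classic) x by rewrite -E; left.
    by move=> -[_ /=]; rewrite in_itv/= andbT; exact: lt_trans.
  by rewrite memNset.
Qed.

Lemma ge0_integral_completed (F : R -> \bar R) :
  measurable_fun setT F -> (forall x, 0 <= F x)%E ->
  (\int[cmu]_x F x = \int[mu]_x F x)%E.
Proof.
move=> mF F0.
have mid : measurable_fun setT (idfun : lebesgueR R -> measurableTypeR R).
  by move=> _ B mB; rewrite setTI; exact: sub_caratheodory.
transitivity (\int[pushforward cmu (idfun : lebesgueR R -> measurableTypeR R)]_x F x)%E.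
  by rewrite ge0_integral_pushforward.
by apply: eq_measure_integral => A mA _.
Qed.

(** Measurability is asked of [f0] and passes to [f] because the measure is complete; the two
    integrands then agree almost everywhere. *)
Lemma LpI_ae_eq p I f f0 N : (1 <= p)%E -> measurable I -> measurable N ->
  mu N = 0 -> measurable_fun setT f0 ->
  (forall x, I x -> ~ N x -> f x = f0 x) -> LpI p I f = LpI p I f0.
Proof.
move=> p1 mI mN N0 mf0 ff0; rewrite /LpI.
set F := fun x => _; set F0 := fun x => _.
have aeF : \forall x \ae cmu, F0 x = F x.
  exists N; split => //; first exact: sub_caratheodory.
  move=> x /=; apply: contra_notP => Nx; rewrite /F /F0 !patchE.
  by case: ifPn => //; rewrite inE => Ix; rewrite ff0.
have mF0 : measurable_fun setT (F0 : lebesgueR R -> \bar R).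
  move=> _ B mB; rewrite setTI; apply: sub_caratheodory.
  rewrite -[_ @^-1` _]setTI.
  have : measurable_fun [set: R] F0; last exact.
  apply/measurable_EFinP; apply/(measurable_restrictT _ mI).
  exact: measurable_funTS.
have mF : measurable_fun setT (F : lebesgueR R -> \bar R).
  apply: (@ae_measurable_fun _ _ _ cmu _ setT F0) => //.
    exact: completed_lebesgue_measure_is_complete.
  by apply: filterS aeF.
clearbody F F0; rewrite Lnorm.unlock; case: p p1 => [p||]// _; last first.
  case: ifP => // _; apply: eq_ess_sup.
  by apply: filterS aeF => x /= ->.
have mp (G : lebesgueR R -> \bar R) : measurable_fun setT G ->
    measurable_fun setT (fun x => `|G x| `^ p)%E.
  move=> mG; apply: (measurableT_comp (measurable_poweR p)).
  exact: measurableT_comp.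
congr (_ `^ _)%E.
apply: (ge0_ae_eq_integral measurableT (mp _ mF) (mp _ mF0)).
- by move=> x _; exact: poweR_ge0.
- by move=> x _; exact: poweR_ge0.
by apply: filterS aeF => x + _ => /= ->.
Qed.

Lemma LpI_fin (p : R) I f : measurable I -> measurable_fun setT f ->
  1 <= p -> LpI p%:E I f = ((\int[mu]_(x in I) (`|f x| `^ p)%:E) `^ p^-1)%E.
Proof.
move=> mI mf p1; rewrite /LpI Lnorm.unlock; congr (_ `^ _)%E.
rewrite [RHS]integral_mkcond -ge0_integral_completed; last 2 first.
- apply/(measurable_restrictT _ mI); apply: measurable_funTS.
  apply/measurable_EFinP; apply: (measurableT_comp (measurable_powR p)).
  exact: measurableT_comp.
- by move=> x; rewrite patchE; case: ifP => // _; rewrite lee_fin powR_ge0.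
apply: eq_integral => x _; rewrite !patchE; case: ifP => // _.
by rewrite /= normr0 powR0// gt_eqF// (lt_le_trans ltr01).
Qed.

Lemma LpIy_le I f (M : R) : measurable I -> measurable_fun setT f -> 0 <= M ->
  (LpI +oo I f <= M%:E)%E <-> mu [set x | I x /\ M < `|f x|] = 0.
Proof.
move=> mI mf M0; rewrite /LpI Lnorm.unlock.
(* For [p = +oo] the norm is defined by cases on whether the whole space has positive measure. *)
have cT : (0 < cmu setT)%E.
  rewrite (_ : cmu setT = mu setT)//.
  have := @lebesgue_measure_itv R `]-oo, +oo[; rewrite set_itvNyy => ->.
  by rewrite /= addye// lt0y.
have mE : measurable [set x | I x /\ M < `|f x|].
  have : measurable (I `&` (Num.norm \o f) @^-1` `]M, +oo[%classic).
    apply: measurableI => //; rewrite -[_ @^-1` _]setTI.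
    have : measurable_fun setT (Num.norm \o f) by exact: measurableT_comp.
    by apply => //; exact: measurable_itv.
  congr measurable; apply/seteqP; split=> x /=; rewrite in_itv/= andbT//.
rewrite cT; split=> [/ess_supP[N [mN N0 sN]]|E0].
  apply: (subset_measure0 (mu := cmu) _ mN _ N0).
    exact: sub_caratheodory.
  move=> x /= [Ix Mx]; apply: sN => /=; rewrite patchE mem_set// lee_fin.
  by apply/negP; rewrite -ltNge.
apply/ess_supP; exists [set x | I x /\ M < `|f x|]; split => //.
  exact: sub_caratheodory.
move=> x /=; rewrite patchE; case: ifPn => [|_].
  by rewrite inE lee_fin => Ix /negP; rewrite -ltNge.
by rewrite normr0 lee_fin.
Qed.

End Completion.

(** * From integrals of nondecreasing functions to Lp norms *)

Section Transfer.
Variable R : realType.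
Local Notation mu := (@lebesgue_measure R).

Definition gauge (Phi : R -> \bar R) := [/\ measurable_fun setT Phi,
  forall y, (0 <= Phi y)%E & forall x y, 0 <= x -> x <= y -> (Phi x <= Phi y)%E].

Lemma gauge_powR (p : R) : 0 <= p -> gauge (fun y => (`|y| `^ p)%:E).
Proof.
move=> p0; split=> [|y|x y x0 xy].
- apply/measurable_EFinP; apply: (measurableT_comp (measurable_powR p)).
  exact: normr_measurable.
- by rewrite lee_fin powR_ge0.
have y0 := le_trans x0 xy.
by rewrite lee_fin ge0_ler_powR ?nnegrE// !ger0_norm.
Qed.

Lemma gauge_gt (B : R) : gauge (fun y => (\1_(`]B, +oo[%classic) y)%:E).
Proof.
split=> [|y|x y x0 xy].
- by apply/measurable_EFinP; apply: measurable_indic; exact: measurable_itv.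
- by rewrite lee_fin indicE ler0n.
rewrite lee_fin !indicE; case: (boolP (x \in _)) => //.
rewrite inE/= in_itv/= andbT => Bx; rewrite mem_set//=.
by rewrite in_itv/= andbT (lt_le_trans Bx).
Qed.

Lemma LpIZ (p : \bar R) (I : set R) (f : R -> R) (c : R) : (1 <= p)%E ->
  measurable I -> measurable_fun setT f -> 0 < c ->
  LpI p I (fun x => c * f x) = (c%:E * LpI p I f)%E.
Proof.
move=> p1 mI mf c0.
case: p p1 => [p||]// p1; last first.
  rewrite /LpI Lnorm.unlock; case: ifP => cT; last by rewrite mule0.
  rewrite -ess_sup_pZl//; apply: eq_ess_sup; apply: nearW => x /=.
  by rewrite !patchE; case: ifP => _; rewrite -?EFinM ?normr0 ?mulr0// normrM gtr0_norm.
have p0 : 0 < p by rewrite (lt_le_trans ltr01).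
have mfp : measurable_fun I (fun x => (`|f x| `^ p)%:E).
  apply: measurable_funTS; apply/measurable_EFinP.
  by apply: (measurableT_comp (measurable_powR p)); exact: measurableT_comp.
rewrite !LpI_fin//; last exact: measurable_funM.
under eq_integral do rewrite normrM powRM// EFinM.
rewrite ge0_integralZl//.
rewrite poweRM ?lee_fin ?powR_ge0//; last by apply: integral_ge0 => x _; rewrite lee_fin powR_ge0.
by rewrite poweR_EFin -powRrM mulfV ?gt_eqF// powRr1// gtr0_norm.
Qed.

(* [Phi y = y ^ p] handles [p < +oo], the indicator of [y > B] handles [p = +oo]. *)
Lemma LpI_le_of_gauge (J : Type) (p : \bar R) (C : R) (I : set R) (f : R -> R)
    (Ij : J -> set R) (fj : J -> R -> R) (B : \bar R) :
  (1 <= p)%E -> 1 <= C -> (0 <= B)%E ->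
  measurable I -> measurable_fun setT f ->
  (forall j, measurable (Ij j)) -> (forall j, measurable_fun setT (fj j)) ->
  (forall Phi M, gauge Phi ->
     (forall j, \int[mu]_(x in Ij j) Phi (`|fj j x|)%R <= M)%E ->
     (\int[mu]_(x in I) Phi (`|f x|)%R <= C%:E * M)%E) ->
  (forall j, LpI p (Ij j) (fj j) <= B)%E -> (LpI p I f <= C%:E * B)%E.
Proof.
move=> p1 C1 + mI mf mIj mfj H; have C0 : 0 < C by rewrite (lt_le_trans ltr01).
case: B => [B||]//; last by move=> _ _; rewrite mulry gtr0_sg// mul1e leey.
rewrite lee_fin => B0 HB.
case: p p1 HB => [p||]// p1 HB; last first.
  apply: (@le_trans _ _ B%:E); last by rewrite -EFinM lee_fin ler_peMl.
  have E (g : R -> R) (A : set R) : measurable A -> measurable_fun setT g ->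
      (\int[mu]_(x in A) (\1_(`]B, +oo[%classic) `|g x|)%:E)%E =
      mu [set x | A x /\ B < `|g x|].
    move=> mA mg; rewrite (_ : [set _ | _] = ((fun x => `|g x|) @^-1` `]B, +oo[%classic) `&` A).
      rewrite -integral_indic//; last first.
        rewrite -[_ @^-1` _]setTI.
        have : measurable_fun setT (fun x => `|g x|) by exact: measurableT_comp.
        by apply => //; exact: measurable_itv.
    apply/seteqP; split=> x /=; rewrite in_itv/= andbT; tauto.
  apply/(LpIy_le mI mf B0).
  (* With [M = 0] the hypothesis says that every [fj j] is bounded by [B] almost everywhere, and the
     conclusion says the same of [f]. *)
  have := H _ 0%E (gauge_gt B); rewrite mule0 E// => H0.
  apply/eqP; rewrite eq_le measure_ge0 andbT; apply: H0 => j.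
  by rewrite E//; move/(LpIy_le (mIj j) (mfj j) B0): (HB j) => ->.
have p0 : 0 < p by rewrite (lt_le_trans ltr01).
have poweRK (x : \bar R) q : (0 <= x)%E -> q != 0 -> ((x `^ q) `^ q^-1 = x)%E.
  by move=> x0 q0; rewrite -poweRrM mulfV// poweRe1.
have int0 (g : R -> R) (A : set R) : (0 <= \int[mu]_(x in A) (`|g x| `^ p)%:E)%E.
  by apply: integral_ge0 => x _; rewrite lee_fin powR_ge0.
rewrite LpI_fin//.
have := H _ (B%:E `^ p)%E (gauge_powR (ltW p0)).
have E (g : R -> R) (A : set R) : (\int[mu]_(x in A) (`| `|g x| | `^ p)%:E =
    \int[mu]_(x in A) (`|g x| `^ p)%:E)%E.
  by apply: eq_integral => x _; rewrite normr_id.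
rewrite E => H0.
have {}H0 : (\int[mu]_(x in I) (`|f x| `^ p)%:E <= C%:E * B%:E `^ p)%E.
  apply: H0 => j; rewrite E.
  have := HB j; rewrite LpI_fin// => /(gt0_ler_poweR (ltW p0)).
  rewrite !in_itv/= !leey !andbT poweR_ge0 lee_fin B0 => /(_ isT isT).
  by rewrite -[X in (_ `^ X)%E]invrK poweRK ?invr_eq0 ?gt_eqF// invrK.
have := @gt0_ler_poweR _ p^-1 _ _ _ _ _ H0.
rewrite !in_itv/= !leey !andbT invr_ge0 (ltW p0) int0 mule_ge0 ?lee_fin ?(ltW C0) ?poweR_ge0//.
move=> /(_ isT isT) H1; apply: (le_trans (H1 _)) => //.
rewrite -EFinM lee_fin powRM ?powR_ge0 ?(ltW C0)// -powRrM mulfV ?gt_eqF// powRr1//.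
(* [C ^ (1/p) <= C], since [C >= 1] and [1/p <= 1]. *)
apply: ler_wpM2r => //; rewrite -[leRHS]powRr1 ?(ltW C0)// ler_powR// invf_le1//.
exact: powR_ge0.
Qed.

(** Two kinds of loss are kept apart: [C] multiplies integrals and stays outside [Phi], while [K]
    rescales values inside [Phi] and leaves the norm by homogeneity. *)
Lemma LpI_le_of_gauge_scaled (J : Type) (p : \bar R) (C K : R) (I : set R) (f : R -> R)
    (Ij : J -> set R) (fj : J -> R -> R) (B : \bar R) :
  (1 <= p)%E -> 1 <= C -> 0 < K -> (0 <= B)%E ->
  measurable I -> measurable_fun setT f ->
  (forall j, measurable (Ij j)) -> (forall j, measurable_fun setT (fj j)) ->
  (forall Phi M, gauge Phi ->
     (forall j, \int[mu]_(x in Ij j) Phi (`|fj j x|)%R <= M)%E ->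
     (\int[mu]_(x in I) Phi (`|f x| / K)%R <= C%:E * M)%E) ->
  (forall j, LpI p (Ij j) (fj j) <= B)%E -> (LpI p I f <= (K * C)%:E * B)%E.
Proof.
move=> p1 C1 K0 B0 mI mf mIj mfj H HB.
have mKf : measurable_fun setT (fun x => K^-1 * f x) by exact: measurable_funM.
rewrite EFinM -muleA -lee_pdivrMl// -LpIZ// ?invr_gt0//.
apply: (LpI_le_of_gauge p1 C1 B0 mI mKf mIj mfj) => // Phi M gP HM.
under eq_integral do rewrite normrM gtr0_norm ?invr_gt0// mulrC.
exact: H.
Qed.

End Transfer.

(** * Finite differences *)

Section Differences.
Variable R : realType.
Implicit Types (G : R -> R) (k : nat) (s y : R).
Local Notation mu := (@lebesgue_measure R).

(** Unlike [Delta], it starts from the first node and makes no domain test, so that the algebraic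
    identities below hold on the whole line. *)
Definition fd k s G y : R :=
  \sum_(0 <= i < k.+1) 'C(k, i)%:R * (-1) ^+ (k - i) * G (y + i%:R * s).

Lemma sum_signed_bin k : (0 < k)%N ->
  \sum_(0 <= i < k.+1) 'C(k, i)%:R * (-1) ^+ (k - i) = 0 :> R.
Proof.
move=> k0; have := @exprDn R (-1) 1 k; rewrite addNr expr0n eqn0Ngt k0 => E.
rewrite big_mkord; apply: (etrans _ (esym E)).
by apply: eq_bigr => i _; rewrite expr1n mulr1 mulr_natl.
Qed.

(* The terms with [i = 0] give [- D_eta]; the full sum over [i <= k] vanishes since
   exchanging the two summation indices exchanges the two families of nodes. *)
Lemma fd_averaging k G y eta sigma : (0 < k)%N ->
  fd k eta G y = \sum_(i < k) (-1) ^+ i.+1 * 'C(k, i.+1)%:R *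
    (fd k (i.+1%:R * sigma) G (y + i.+1%:R * eta) - fd k (eta + i.+1%:R * sigma) G y).
Proof.
move=> k0.
pose c i : R := (-1) ^+ i * 'C(k, i)%:R.
pose g i := c i * (fd k (i%:R * sigma) G (y + i%:R * eta) - fd k (eta + i%:R * sigma) G y).
have g0 : g 0%N = - fd k eta G y.
  rewrite /g /c expr0 bin0 !mul1r !mul0r !addr0 (_ : fd k 0 G y = 0) ?sub0r//.
  rewrite /fd (eq_bigr (fun i => 'C(k, i)%:R * (-1) ^+ (k - i) * G y)).
    by rewrite -mulr_suml sum_signed_bin// mul0r.
  by move=> i _; rewrite mulr0 addr0.
suff : \sum_(i < k.+1) g i = 0.
  rewrite big_ord_recl/= g0 => /eqP; rewrite addrC subr_eq0 => /eqP <-.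
  by apply: eq_bigr => i _.
rewrite /g; under eq_bigr do rewrite mulrBr.
rewrite sumrB; apply/eqP; rewrite subr_eq0; apply/eqP.
pose t i j : R := c i * ('C(k, j)%:R * (-1) ^+ (k - j) *
  G (y + i%:R * eta + j%:R * (i%:R * sigma))).
transitivity (\sum_(i < k.+1) \sum_(j < k.+1) t i j).
  by apply: eq_bigr => i _; rewrite /fd big_mkord mulr_sumr.
rewrite exchange_big/=; apply: eq_bigr => i _.
rewrite /fd big_mkord mulr_sumr; apply: eq_bigr => j _; rewrite /t /c.
have sgn (a : nat) : (a <= k)%N -> (-1) ^+ (k - a) = (-1) ^+ k * (-1) ^+ a :> R.
  by move=> ak; rewrite -[in (-1) ^+ k](subnK ak) exprD -mulrA -exprMn mulrNN mulr1 expr1n mulr1.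
rewrite !sgn -1?ltnS//.
rewrite (_ : y + j%:R * eta + i%:R * (j%:R * sigma) =
  y + j%:R * (eta + i%:R * sigma)); last by ring.
by ring.
Qed.

(** Pascal's rule; it drives the induction in [fd_double]. *)
Lemma fdS k s G y : fd k.+1 s G y = fd k s G (y + s) - fd k s G y.
Proof.
rewrite /fd big_nat_recl//.
under eq_big_nat => i /andP[_ ik].
  rewrite binS natrD subSS !mulrDl (_ : y + i.+1%:R * s = y + s + i%:R * s); last first.
    by rewrite -natr1; ring.
  over.
rewrite big_split/= big_nat_recr//= (@bin_small k k.+1)// !mul0r addr0.
rewrite addrCA addrA addrC; congr (_ + _).
rewrite addr0 big_nat_recl// opprD addrC; congr (_ + _).
  by rewrite !bin0 !subn0 mul0r addr0 exprS; ring.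
rewrite -sumrN; apply: eq_big_nat => i /andP[_ ik].
rewrite (_ : (k - i = (k - i.+1).+1)%N); last by rewrite subnSK.
rewrite exprS (_ : y + i.+1%:R * s = y + s + i%:R * s); last by rewrite -natr1; ring.
by ring.
Qed.

(* [(E^2 - 1)^k = (E + 1)^k (E - 1)^k] for the shift [E] by [s]. *)
Lemma fd_double k s G y :
  fd k (2 * s) G y = \sum_(0 <= j < k.+1) 'C(k, j)%:R * fd k s G (y + j%:R * s).
Proof.
(* [S n] is the operator [(E + 1)^n]; the three facts that follow are its recursion, its additivity
   and its commutation with [E]. *)
pose S n (H : R -> R) z := \sum_(0 <= j < n.+1) 'C(n, j)%:R * H (z + j%:R * s).
have SS n H z : S n.+1 H z = S n H (z + s) + S n H z.
  rewrite /S big_nat_recl//.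
  under eq_big_nat => i _.
    rewrite binS natrD mulrDl (_ : z + i.+1%:R * s = z + s + i%:R * s); last first.
      by rewrite -natr1; ring.
    over.
  rewrite big_split/= big_nat_recr//= (@bin_small n n.+1)// !mul0r !addr0.
  rewrite addrA addrC; congr (_ + _); rewrite [RHS]big_nat_recl// !bin0 mul0r addr0.
  congr (_ + _); apply: eq_big_nat => i _.
  by rewrite (_ : z + i.+1%:R * s = z + s + i%:R * s)// -natr1; ring.
have SB n H H' z : S n (fun u => H u - H' u) z = S n H z - S n H' z.
  by rewrite /S -sumrB; apply: eq_bigr => i _; rewrite mulrBr.
have ST n H z : S n (fun u => H (u + s)) z = S n H (z + s).
  by apply: eq_bigr => i _; rewrite addrAC.
rewrite -[RHS]/(S k (fd k s G) y).
elim: k y => [|k IH] y; first by rewrite /S /fd !big_nat1 /= !mul0r !addr0 !mul1r.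
rewrite fdS SS !IH (_ : fd k.+1 s G = fun u => fd k s G (u + s) - fd k s G u).
  rewrite !SB !(ST k (fd k s G)) (_ : y + 2 * s = y + s + s); last by ring.
  by ring.
by apply/funext => u; rewrite fdS.
Qed.

(** Summing over [k - i] reverses the order of the nodes. This lets the right endpoint be treated as
    a left one. *)
Lemma fd_reflect k s G c y :
  fd k s (fun u => G (c - u)) y = (-1) ^+ k * fd k s G (c - y - k%:R * s).
Proof.
rewrite /fd !big_mkord [RHS]mulr_sumr (reindex_inj rev_ord_inj)/=.
apply: eq_bigr => i _; have ik : (i <= k)%N by rewrite -ltnS.
rewrite subSS subKn// bin_sub// natrB//.
rewrite (_ : c - (y + (k%:R - i%:R) * s) = c - y - k%:R * s + i%:R * s); last by ring.
rewrite -[in (-1) ^+ k](subnK ik) exprD.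
have aa : (-1) ^+ (k - i) * (-1) ^+ (k - i) = 1 :> R.
  by rewrite -exprMn mulrNN mulr1 expr1n.
rewrite -[LHS]mul1r -[X in X * _ = _]aa.
by ring.
Qed.

Lemma measurable_fd k s G : measurable_fun setT G -> measurable_fun setT (fd k s G).
Proof.
move=> mG; apply: measurable_sum => i.
apply: measurable_funM => //; apply: measurableT_comp => //.
exact: measurable_funD.
Qed.

Lemma measurable_fd2 k G : measurable_fun setT G ->
  measurable_fun setT (fun p : R * R => fd k p.1 G p.2).
Proof.
move=> mG; apply: measurable_sum => i.
apply: measurable_funM => //; apply: measurableT_comp => //.
apply: measurable_funD; first exact: measurable_snd.
by apply: measurable_funM => //; exact: measurable_fst.
Qed.
End Differences.

(** * Gauges of finite differences *)

Section GaugeBounds.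
Variable R : realType.
Local Notation mu := (@lebesgue_measure R).
Implicit Types (G v : R -> R) (k : nat) (Phi : R -> \bar R).

Lemma gauge_scale Phi (c : R) : 0 < c -> gauge Phi -> gauge (fun y => Phi (y / c)).
Proof.
move=> c0 [mPhi P0 Pm]; split => [|y|x y x0 xy]; last 2 first.
- exact: P0.
- by apply: Pm; [rewrite divr_ge0// ltW|rewrite ler_pM2r// invr_gt0].
by apply: (measurableT_comp mPhi); apply: measurable_funM.
Qed.

(* The largest [z i] already dominates [y]: no convexity of [Phi] is needed. *)
Lemma gauge_le_sum (I : finType) (i0 : I) Phi (c z : I -> R) (y : R) :
  gauge Phi -> 0 <= y -> (forall i, 0 <= c i) -> \sum_i c i <= 1 ->
  (forall i, 0 <= z i) -> y <= \sum_i c i * z i ->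
  (Phi y <= \sum_i Phi (z i))%E.
Proof.
move=> [_ P0 Pm] y0 c0 c1 z0 yz.
have [i _ zi] := @Order.TotalTheory.arg_maxP _ _ I i0 xpredT z isT.
have yzi : y <= z i.
  apply: (le_trans yz); apply: (@le_trans _ _ (\sum_j c j * z i)).
    by apply: ler_sum => j _; apply: ler_wpM2l => //; exact: zi.
  by rewrite -mulr_suml ler_piMl.
apply: (le_trans (Pm _ _ y0 yzi)).
by rewrite (bigD1 i)//= leeDl// sume_ge0.
Qed.

Lemma sum_bin k : \sum_(i < k.+1) 'C(k, i)%:R = 2 ^+ k :> R.
Proof.
rewrite (_ : 2 = 1 + 1 :> R)// exprDn; apply: eq_bigr => i _.
by rewrite !expr1n mul1r.
Qed.

(** The coefficients of [fd_double] sum to [2 ^ k], and dividing by it brings them under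
    [gauge_le_sum]. *)
Lemma gauge_fd_double Phi k G (V s y : R) : gauge Phi -> 0 <= V ->
  (Phi (V * `|fd k (2 * s) G y| / 2 ^+ k)%R <=
   \sum_(j < k.+1) Phi (V * `|fd k s G (y + j%:R * s)|)%R)%E.
Proof.
move=> gP V0; have k0 : 0 < 2 ^+ k :> R by rewrite exprn_gt0.
apply: (@gauge_le_sum _ ord0 _ (fun j : 'I_k.+1 => 'C(k, j)%:R / 2 ^+ k)) => //.
- by rewrite divr_ge0 ?mulr_ge0// ltW.
- by rewrite -mulr_suml sum_bin divff// gt_eqF.
- by move=> j; rewrite mulr_ge0.
rewrite fd_double big_mkord.
under [leRHS]eq_bigr do rewrite mulrAC.
rewrite -mulr_suml ler_pM2r ?invr_gt0//.
rewrite -[X in X * _ <= _]ger0_norm// -normrM mulr_sumr.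
apply: (le_trans (ler_norm_sum _ _ _)); apply: ler_sum => i _.
by rewrite mulrCA normrM (ger0_norm (ler0n _ _)) normrM (ger0_norm V0).
Qed.

(** Each bracket of [fd_averaging] is at most twice the larger of its two terms, and the
    coefficients [2 * C(k, i)] with [i >= 1] sum to at most [2 ^ (k + 1)]. *)
Lemma gauge_fd_averaging Phi k G (V eta sigma y : R) : gauge Phi -> 0 <= V ->
  (0 < k)%N ->
  (Phi (V * `|fd k eta G y| / 2 ^+ k.+1)%R <=
   \sum_(i < k) (Phi (V * `|fd k (i.+1%:R * sigma) G (y + i.+1%:R * eta)|)%R +
                 Phi (V * `|fd k (eta + i.+1%:R * sigma) G y|)%R))%E.
Proof.
move=> gP V0 k0; have [_ P0 Pm] := gP.
have k20 : 0 < 2 ^+ k.+1 :> R by rewrite exprn_gt0.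
pose a (i : 'I_k) := V * `|fd k (i.+1%:R * sigma) G (y + i.+1%:R * eta)|.
pose b (i : 'I_k) := V * `|fd k (eta + i.+1%:R * sigma) G y|.
have a0 i : 0 <= a i by rewrite mulr_ge0.
have b0 i : 0 <= b i by rewrite mulr_ge0.
apply: (@le_trans _ _ (\sum_(i < k) Phi (Num.max (a i) (b i))%R)%E); last first.
  apply: lee_sum => i _; rewrite /Num.max; case: ifP => _.
    by rewrite leeDr.
  by rewrite leeDl.
have i0 : 'I_k by exists 0%N.
apply: (@gauge_le_sum _ i0 _ (fun i : 'I_k => 2 * 'C(k, i.+1)%:R / 2 ^+ k.+1)) => //.
- by rewrite divr_ge0 ?mulr_ge0// ltW.
- rewrite -mulr_suml -mulr_sumr ler_pdivrMr// mul1r exprS ler_pM2l//.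
  by rewrite -sum_bin big_ord_recl lerDr.
- by move=> i; rewrite le_max a0.
rewrite (fd_averaging _ _ _ sigma k0).
under [leRHS]eq_bigr do rewrite mulrAC.
rewrite -mulr_suml ler_pM2r ?invr_gt0//.
rewrite -[X in X * _ <= _]ger0_norm// -normrM mulr_sumr.
apply: (le_trans (ler_norm_sum _ _ _)); apply: ler_sum => i _.
rewrite mulrCA normrM normrM normrX normrN1 expr1n mul1r (ger0_norm (ler0n _ _)).
rewrite (mulrC 2) -mulrA; apply: ler_wpM2l; first exact: ler0n.
rewrite mulrBr; apply: (le_trans (ler_normB _ _)).
rewrite !normrM (ger0_norm V0) -/(a i) -/(b i).
have aM : a i <= Num.max (a i) (b i) by rewrite le_max lexx.
have bM : b i <= Num.max (a i) (b i) by rewrite le_max lexx orbT.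
lra.
Qed.
End GaugeBounds.

(** * Tonelli's theorem on rectangles and substitution in two variables *)

Section Tonelli.
Variable R : realType.
Local Notation mu := (@lebesgue_measure R).
Implicit Types (h : R * R -> \bar R) (X Y S T : set R).

Lemma measurable_patchX h X Y : measurable_fun setT h -> measurable X -> measurable Y ->
  measurable_fun setT (h \_ (X `*` Y)).
Proof.
move=> mh mX mY; apply/(measurable_restrictT _ (measurableX mX mY)).
exact: measurable_funTS.
Qed.

Lemma patchX0 h X Y : (forall z, 0 <= h z)%E ->
  forall z, (0 <= (h \_ (X `*` Y)) z)%E.
Proof. by move=> h0 z; rewrite patchE; case: ifP. Qed.

Lemma measurable_integral_snd h S : measurable_fun setT h -> measurable S ->
  (forall z, 0 <= h z)%E -> measurable_fun setT (fun x => \int[mu]_(y in S) h (x, y))%E.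
Proof.
move=> mh mS h0.
have := @measurable_fun_fubini_tonelli_F _ _ _ _ _ mu (h \_ (setT `*` S))
  (measurable_patchX mh measurableT mS) (patchX0 _ _ h0).
rewrite /fubini_F; congr (measurable_fun _ _); apply/funext => x.
rewrite [RHS]integral_mkcond; apply: eq_integral => y _.
by rewrite !patchE in_setX mem_setT.
Qed.

Lemma measurable_integral_fst h S : measurable_fun setT h -> measurable S ->
  (forall z, 0 <= h z)%E -> measurable_fun setT (fun y => \int[mu]_(x in S) h (x, y))%E.
Proof.
move=> mh mS h0; apply: (@measurable_integral_snd (fun p => h (p.2, p.1))) => //.
by apply: measurableT_comp => //; apply: measurable_fun_pair.
Qed.

Lemma tonelli_on h X S : measurable_fun setT h -> measurable X -> measurable S ->
  (forall z, 0 <= h z)%E ->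
  (\int[mu]_(x in X) \int[mu]_(y in S) h (x, y) =
   \int[mu]_(y in S) \int[mu]_(x in X) h (x, y))%E.
Proof.
move=> mh mX mS h0.
have := @fubini_tonelli _ _ _ _ _ mu mu (h \_ (X `*` S))
  (measurable_patchX mh mX mS) (patchX0 _ _ h0).
move=> E; rewrite [RHS]integral_mkcond [LHS]integral_mkcond.
transitivity (\int[mu]_x \int[mu]_y (h \_ (X `*` S)) (x, y))%E.
  apply: eq_integral => x _; rewrite patchE; case: ifPn => xX.
    rewrite integral_mkcond; apply: eq_integral => y _.
    by rewrite !patchE in_setX xX.
  rewrite integral0_eq// => y _; by rewrite patchE in_setX (negbTE xX).
rewrite E; apply: eq_integral => y _; rewrite patchE; case: ifPn => yS.
  rewrite [RHS]integral_mkcond; apply: eq_integral => x _.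
  by rewrite !patchE in_setX yS andbT.
by rewrite integral0_eq// => x _; rewrite patchE in_setX (negbTE yS) andbF.
Qed.

(** For fixed [x] the substitution [tau = zeta (x, s)] costs nothing; after exchanging the
    integrals, the substitution [u = z x] for fixed [tau] costs [m^-1]. *)
Lemma integral_expanding2 h (zeta : R * R -> R) (z : R -> R) (m : R) X Y S T :
  measurable_fun setT h -> (forall p, 0 <= h p)%E ->
  measurable X -> measurable Y -> measurable S -> measurable T -> 0 < m ->
  measurable_fun setT zeta -> measurable_fun setT z ->
  (forall x, X x -> expanding 1 S (fun s => zeta (x, s))) ->
  (forall x s, X x -> S s -> T (zeta (x, s))) ->
  expanding m X z -> (forall x, X x -> Y (z x)) ->
  (\int[mu]_(x in X) \int[mu]_(s in S) h (zeta (x, s), z x) <=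
   m^-1%:E * \int[mu]_(tau in T) \int[mu]_(u in Y) h (tau, u))%E.
Proof.
move=> mh h0 mX mY mS mT m0 mzeta mz zetaex zetaT zex zY.
have mhz : measurable_fun setT (fun p : R * R => h (p.2, z p.1)).
  apply: (measurableT_comp mh); apply: measurable_fun_pair => //.
  by apply: measurableT_comp.
have mhz2 : measurable_fun setT (fun p : R * R => h (zeta p, z p.1)).
  apply: (measurableT_comp mh); apply: measurable_fun_pair => //.
  by apply: measurableT_comp.
apply: (@le_trans _ _ (\int[mu]_(x in X) \int[mu]_(tau in T) h (tau, z x))%E).
  apply: ge0_le_integral => //.
  - by move=> x _; apply: integral_ge0.
  - apply: measurable_funTS.
    exact: (@measurable_integral_snd (fun p => h (zeta p, z p.1))).
  - apply: measurable_funTS.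
    exact: (@measurable_integral_snd (fun p => h (p.2, z p.1))).
  move=> x Xx.
  have := @ge0_integral_expanding R 1 S T (fun s => zeta (x, s)) (fun tau => h (tau, z x)).
  rewrite invr1 mul1e; apply => //.
  - by apply: measurableT_comp.
  - exact: zetaex.
  - by move=> s Ss; exact: zetaT.
  - by apply: measurableT_comp.
rewrite (@tonelli_on (fun p => h (p.2, z p.1)))//=.
rewrite -ge0_integralZl//; first last.
- by rewrite lee_fin invr_ge0 ltW.
- by move=> tau _; exact: integral_ge0.
- apply: measurable_funTS; exact: (@measurable_integral_snd h).
apply: ge0_le_integral => //.
- by move=> tau _; exact: integral_ge0.
- apply: measurable_funTS.
  exact: (@measurable_integral_fst (fun p => h (p.2, z p.1))).
- apply: measurable_funTS; apply: measurable_funeM.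
  exact: (@measurable_integral_snd h).
move=> tau Ttau.
apply: (@ge0_integral_expanding R m X Y z (fun u => h (tau, u))) => //.
by apply: measurableT_comp.
Qed.
End Tonelli.

(** * Averaging over steps on a half-line *)

Section HalfLine.
Variables (R : realType) (k : nat) (G v : R -> R).
Local Notation mu := (@lebesgue_measure R).
Hypotheses (k0 : (0 < k)%N) (mG : measurable_fun setT G) (mv : measurable_fun setT v).
Hypotheses (v0 : forall u, 0 <= v u)
  (vm : forall u u' : R, 0 <= u -> u <= u' -> v u <= v u').
Implicit Types (Phi : R -> \bar R) (M : \bar R).

(** The weight sits at the node nearest the endpoint 0. As [v] is nondecreasing, moving the base
    point to the right can only increase it. *)
Definition wfd (tau u : R) : R := v u * `|fd k tau G u|.

Lemma measurable_wfd2 : measurable_fun setT (fun p : R * R => wfd p.1 p.2).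
Proof.
apply: measurable_funM; first by apply: measurableT_comp.
by apply: measurableT_comp => //; exact: measurable_fd2.
Qed.

Lemma measurable_gauge_wfd2 Phi : gauge Phi ->
  measurable_fun setT (fun p : R * R => Phi (wfd p.1 p.2)).
Proof. by move=> [mPhi _ _]; apply: measurableT_comp => //; exact: measurable_wfd2. Qed.

Lemma measurable_gauge_wfd Phi (eta z : R -> R) : gauge Phi ->
  measurable_fun setT eta -> measurable_fun setT z ->
  measurable_fun setT (fun x => Phi (wfd (eta x) (z x))).
Proof.
move=> gP meta mz.
apply: (@measurableT_comp _ _ _ _ _ _ (fun p => Phi (wfd p.1 p.2)) _
  (fun x => (eta x, z x)) (measurable_gauge_wfd2 gP)).
exact: measurable_fun_pair.
Qed.

Lemma sum_cst_ereal n M : (0 <= M)%E -> (\sum_(i < n) M = n%:R%:E * M)%E.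
Proof.
move=> M0; elim: n => [|n IH]; first by rewrite big_ord0 mul0e.
by rewrite big_ord_recr/= IH -natr1 EFinD ge0_muleDl ?lee_fin// mul1e.
Qed.

Definition bounded_steps Phi (kappa L : R) M := forall s : R, 0 < s -> s <= kappa ->
  (\int[mu]_(u in `[0%R, L]) Phi (wfd s u) <= M)%E.

(** A difference of step [s] is a combination of [k + 1] differences of step [s / 2 <= kappa], whose
    base points lie to the right of the original one by at most [k * kappa]. *)
Lemma bounded_steps_double Phi kappa L M : gauge Phi -> 0 < kappa -> 0 <= L ->
  (0 <= M)%E -> bounded_steps Phi kappa (L + k%:R * kappa) M ->
  bounded_steps (fun y => Phi (y / 2 ^+ k)) (2 * kappa) L (k.+1%:R%:E * M).
Proof.
move=> gP kap0 L0 M0 H s s0 sk; have [mPhi P0 Pm] := gP.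
have g2 : gauge (fun y => Phi (y / 2 ^+ k)).
  by apply: gauge_scale; rewrite ?exprn_gt0.
have s2 : 0 < s / 2 by lra.
have s2k : s / 2 <= kappa by lra.
have mI (a b : R) : measurable (`[a, b]%classic : set R) by exact: measurable_itv.
apply: (@le_trans _ _ (\int[mu]_(u in `[0%R, L])
    \sum_(j < k.+1) Phi (wfd (s / 2) (u + j%:R * (s / 2))))%E).
  apply: ge0_le_integral => //.
  - apply: measurable_funTS.
    exact: (measurable_gauge_wfd g2 (eta := cst s) (z := id)).
  - apply: measurable_funTS; apply: emeasurable_sum => j.
    apply: (measurable_gauge_wfd gP (eta := cst (s / 2))) => //.
    exact: measurable_funD.
  move=> u /=; rewrite in_itv/= => /andP[u0 uL].
  rewrite /wfd (_ : s = 2 * (s / 2)); last by field.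
  apply: (le_trans (gauge_fd_double _ _ _ _ gP (v0 u))).
  rewrite (_ : 2 * (s / 2) / 2 = s / 2); last by field.
  apply: lee_sum => j _; apply: Pm; first by rewrite mulr_ge0.
  by apply: ler_wpM2r => //; apply: vm => //; rewrite lerDl mulr_ge0// ltW.
rewrite ge0_integral_sum//; last first.
  move=> j; apply: measurable_funTS.
  apply: (measurable_gauge_wfd gP (eta := cst (s / 2))) => //.
  exact: measurable_funD.
rewrite -sum_cst_ereal//; apply: lee_sum => j _.
apply: le_trans (H _ s2 s2k).
have := @ge0_integral_expanding R 1 `[0%R, L]%classic `[0%R, L + k%:R * kappa]%classic
  (fun u => u + j%:R * (s / 2)) (fun u => Phi (wfd (s / 2) u)).
rewrite invr1 mul1e; apply => //.
- exact: measurable_funD.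
- by move=> x x' _ _; rewrite mul1r (_ : x + _ - _ = x - x')//; ring.
- move=> u /=; rewrite !in_itv/= => /andP[u0 uL].
  have j0 : 0 <= j%:R * (s / 2) by rewrite mulr_ge0// ltW.
  have jk : j%:R * (s / 2) <= k%:R * kappa.
    by apply: ler_pM => //; [exact: ltW|rewrite ler_nat -ltnS].
  by apply/andP; split; lra.
- by apply: (measurable_gauge_wfd gP (eta := cst (s / 2))).
Qed.

(** The ranges lost in successive doublings form a geometric progression, of total at most
    [k * 2 ^ n * kappa]. *)
Lemma bounded_steps_iter Phi kappa L M n : gauge Phi -> 0 < kappa -> 0 <= L ->
  (0 <= M)%E -> bounded_steps Phi kappa (L + k%:R * (2 ^+ n * kappa)) M ->
  bounded_steps (fun y => Phi (y / 2 ^+ (k * n))) (2 ^+ n * kappa) L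
    ((k.+1%:R ^+ n)%:E * M).
Proof.
move=> + kap0 + M0; elim: n L => [|n IH] L gP L0.
  rewrite muln0 !expr0 mul1r mul1e => H s s0 sk.
  under eq_integral do rewrite divr1.
  apply: le_trans (H s s0 sk); apply: ge0_subset_integral => //.
  - by apply: measurable_funTS; apply: (measurable_gauge_wfd gP (eta := cst s) (z := id)).
  - by move=> u _; have [_ ->] := gP.
  apply: subset_itvl; rewrite bnd_simp lerDl mulr_ge0// ltW//.
move=> H.
have kn0 : 0 < 2 ^+ n * kappa by rewrite mulr_gt0 ?exprn_gt0.
have H1 : bounded_steps Phi kappa
    ((L + k%:R * (2 ^+ n * kappa)) + k%:R * (2 ^+ n * kappa)) M.
  by move: H; rewrite exprS (_ : L + k%:R * (2 * 2 ^+ n * kappa) =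
    L + k%:R * (2 ^+ n * kappa) + k%:R * (2 ^+ n * kappa))//; ring.
have L1 : 0 <= L + k%:R * (2 ^+ n * kappa) by rewrite addr_ge0// mulr_ge0// ltW.
have {}IH := IH _ gP L1 H1.
have g2 : gauge (fun y => Phi (y / 2 ^+ (k * n))).
  by apply: gauge_scale; rewrite ?exprn_gt0.
have := bounded_steps_double g2 kn0 L0 _ IH.
rewrite mule_ge0 ?lee_fin ?exprn_ge0// => /(_ isT).
rewrite muleA -EFinM -exprS mulrA -exprS.
rewrite (_ : (fun y => Phi (y / 2 ^+ k / 2 ^+ (k * n))) =
  (fun y => Phi (y / 2 ^+ (k * n.+1))))//.
by apply/funext => y; rewrite mulnS exprD invfM mulrA.
Qed.

(** The averaging identity is integrated over [sigma] in []0, kappa / k]]. The steps [i * sigma] and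
    [eta + i * sigma] expand in [sigma] and stay below [2 * kappa]; the base points [y + i * eta]
    expand in [x] by [m]. The [2 * k] double integrals, divided by the length [kappa / k], give the
    constant. *)
Lemma integral_averaging_le Phi (kappa L m : R) (X : set R) (y eta : R -> R) :
  gauge Phi -> 0 < kappa -> 0 <= L -> 0 < m -> measurable X ->
  measurable_fun setT y -> measurable_fun setT eta ->
  (forall x, X x -> [/\ 0 <= y x, y x <= L, 0 <= eta x & eta x <= kappa]) ->
  (forall i, (i <= k)%N -> expanding m X (fun x => y x + i%:R * eta x)) ->
  (\int[mu]_(x in X) Phi (wfd (eta x) (y x) / 2 ^+ k.+1)%R <=
   (2 * k%:R ^+ 2 / kappa / m)%:E *
   \int[mu]_(tau in `]0%R, (2 * kappa)%R]) \int[mu]_(u in `[0%R, (L + k%:R * kappa)%R])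
     Phi (wfd tau u))%E.
Proof.
move=> gP kap0 L0 m0 mX my meta Xb Xex; have [mPhi P0 Pm] := gP.
have kR0 : 0 < k%:R :> R by rewrite ltr0n.
have mI (a b : R) : measurable (`[a, b]%classic : set R) by exact: measurable_itv.
have mJ (a b : R) : measurable (`]a, b]%classic : set R) by exact: measurable_itv.
(* Chosen so that [i * sigma <= kappa] for all [i <= k]. *)
pose rho := kappa / k%:R.
have rho0 : 0 < rho by rewrite divr_gt0.
pose S := `]0%R, rho]%classic : set R.
have mS : measurable S by exact: mJ.
set A := (X in (_ <= _ * X)%E).
have A0 : (0 <= A)%E by apply: integral_ge0 => tau _; apply: integral_ge0 => u _; exact: P0.
pose i1 (i : 'I_k) : R := i.+1%:R.
have i11 i : 1 <= i1 i by rewrite ler1n.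
have i1k i : i1 i <= k%:R by rewrite ler_nat.
have i1rho i s : S s -> 0 < i1 i * s /\ i1 i * s <= kappa.
  rewrite /S/= in_itv/= => /andP[s0 sr]; split.
    by rewrite mulr_gt0// (lt_le_trans ltr01).
  rewrite (_ : kappa = k%:R * rho); last by rewrite mulrC divfK// gt_eqF.
  by apply: ler_pM => //; exact: ltW.
pose z i x := y x + i1 i * eta x.
have mz i : measurable_fun setT (z i) by apply: measurable_funD => //; exact: measurable_funM.
pose ze1 i (p : R * R) := i1 i * p.2.
pose ze2 i (p : R * R) := eta p.1 + i1 i * p.2.
have mze1 i : measurable_fun setT (ze1 i) by exact: measurable_funM.
have mze2 i : measurable_fun setT (ze2 i).
  apply: measurable_funD; first exact: measurableT_comp.
  exact: measurable_funM.
have ex1 i (c : R) : expanding 1 S (fun s => c + i1 i * s).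
  move=> s s' _ _; rewrite mul1r.
  rewrite (_ : c + i1 i * s - (c + i1 i * s') = i1 i * (s - s')); last by ring.
  by rewrite normrM ler_peMl// ger0_norm// (le_trans ler01).
pose h (p : R * R) := Phi (wfd p.1 p.2).
have mh : measurable_fun setT h by exact: measurable_gauge_wfd2.
have h0 p : (0 <= h p)%E by exact: P0.
have T1 i : (\int[mu]_(x in X) \int[mu]_(s in S) h (ze1 i (x, s), z i x) <= m^-1%:E * A)%E.
  apply: integral_expanding2 => //.
  - by move=> x _ s s' Ss Ss'; have := ex1 i 0 s s' Ss Ss'; rewrite !add0r.
  - move=> x s _ Ss; have [a0 ak] := i1rho i s Ss.
    by rewrite /= in_itv/= /ze1/= a0/=; lra.
  - exact: (Xex i.+1).
  - move=> x Xx; have [y0 yL e0 ek] := Xb x Xx; rewrite /= in_itv/=.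
    have ie : 0 <= i1 i * eta x by rewrite mulr_ge0// (le_trans ler01).
    have ie' : i1 i * eta x <= k%:R * kappa.
      by apply: ler_pM.
    by apply/andP; rewrite /z; split; lra.
have T2 i : (\int[mu]_(x in X) \int[mu]_(s in S) h (ze2 i (x, s), y x) <= m^-1%:E * A)%E.
  apply: integral_expanding2 => //.
  - by move=> x _; exact: (ex1 i (eta x)).
  - move=> x s Xx Ss; have [a0 ak] := i1rho i s Ss.
    have [y0 yL e0 ek] := Xb x Xx.
    by rewrite /= in_itv/= /ze2/=; apply/andP; split; lra.
  - move=> x x' Xx Xx'; have := Xex 0%N (leq0n _) x x' Xx Xx'.
    by rewrite !mul0r !addr0.
  - move=> x Xx; have [y0 yL e0 ek] := Xb x Xx; rewrite /= in_itv/= y0/=.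
    have : 0 <= k%:R * kappa by rewrite mulr_ge0 ?ltW.
    by lra.
have mh1 i : measurable_fun setT (fun p : R * R => h (ze1 i p, z i p.1)).
  apply: (measurableT_comp mh); apply: measurable_fun_pair => //.
  exact: measurableT_comp.
have mh2 i : measurable_fun setT (fun p : R * R => h (ze2 i p, y p.1)).
  apply: (measurableT_comp mh); apply: measurable_fun_pair => //.
  exact: measurableT_comp.
pose F x := Phi (wfd (eta x) (y x) / 2 ^+ k.+1).
have mF : measurable_fun setT F.
  have g2 : gauge (fun y => Phi (y / 2 ^+ k.+1)).
    by apply: gauge_scale; rewrite ?exprn_gt0.
  exact: (measurable_gauge_wfd g2).
have muS : mu S = rho%:E.
  by rewrite /S lebesgue_measure_itv/= lte_fin rho0 -EFinB subr0.
pose Q x := (\sum_(i < k) (\int[mu]_(s in S) h (ze1 i (x, s), z i x) +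
   \int[mu]_(s in S) h (ze2 i (x, s), y x)))%E.
have main x : X x -> (rho%:E * F x <= Q x)%E.
  move=> Xx; have [y0 yL e0 ek] := Xb x Xx.
  have msnd (g : R * R -> \bar R) : measurable_fun setT g ->
      measurable_fun S (fun s => g (x, s)).
    by move=> mg; apply: measurable_funTS; apply: (measurableT_comp mg).
  (* [rho * F x] is the integral over [s] in [S] of a constant, which the averaging identity bounds
     for each [s] separately. *)
  rewrite muleC -muS -integral_cst//.
  rewrite [leRHS](_ : _ = \int[mu]_(s in S) \sum_(i < k)
     (h (ze1 i (x, s), z i x) + h (ze2 i (x, s), y x)))%E; last first.
    rewrite ge0_integral_sum//; last 2 first.
    - by move=> i; apply: emeasurable_funD; [exact: (msnd _ (mh1 i))|exact: (msnd _ (mh2 i))].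
    - by move=> i s _; rewrite adde_ge0.
    apply: eq_bigr => i _; rewrite ge0_integralD//.
    - exact: (msnd _ (mh1 i)).
    - exact: (msnd _ (mh2 i)).
  apply: ge0_le_integral => //.
  - by move=> s _; exact: P0.
  - apply: emeasurable_sum => i; apply: emeasurable_funD.
    + exact: (msnd _ (mh1 i)).
    + exact: (msnd _ (mh2 i)).
  move=> s Ss; apply: (le_trans (gauge_fd_averaging _ _ s _ gP (v0 (y x)) k0)).
  apply: lee_sum => i _; apply: leeD => //.
  (* The weight is still taken at [y x]; it grows when moved to the shifted base point [z i x]. *)
  apply: Pm; first by rewrite mulr_ge0.
  apply: ler_wpM2r => //; apply: vm => //.
  by rewrite lerDl mulr_ge0// (le_trans ler01).
have rhoF : (rho%:E * \int[mu]_(x in X) F x <= \int[mu]_(x in X) Q x)%E.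
  rewrite -ge0_integralZl//; first last.
  - by rewrite lee_fin ltW.
  - by move=> x _; exact: P0.
  - exact: measurable_funTS.
  apply: ge0_le_integral => //.
  - by move=> x _; apply: mule_ge0; [rewrite lee_fin ltW|exact: P0].
  - by apply: measurable_funeM; exact: measurable_funTS.
  apply: measurable_funTS; apply: emeasurable_sum => i; apply: emeasurable_funD.
  + exact: (measurable_integral_snd (mh1 i)).
  + exact: (measurable_integral_snd (mh2 i)).
have QA : (\int[mu]_(x in X) Q x <= (k%:R * 2 / m)%:E * A)%E.
  rewrite /Q ge0_integral_sum//; last 2 first.
  - move=> i; apply: measurable_funTS; apply: emeasurable_funD.
    + exact: (measurable_integral_snd (mh1 i)).
    + exact: (measurable_integral_snd (mh2 i)).
  - by move=> i x _; rewrite adde_ge0//; exact: integral_ge0.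
  rewrite [leRHS](_ : _ = \sum_(i < k) (m^-1%:E * A + m^-1%:E * A))%E; last first.
    have mA : (0 <= m^-1%:E * A)%E by rewrite mule_ge0// lee_fin invr_ge0 ltW.
    rewrite sum_cst_ereal ?adde_ge0// -ge0_muleDl ?lee_fin ?invr_ge0 ?ltW//.
    rewrite muleA -EFinD -EFinM; congr (_%:E * _)%E; ring.
  apply: lee_sum => i _; rewrite ge0_integralD//; last 4 first.
  - by move=> x _; exact: integral_ge0.
  - by apply: measurable_funTS; exact: (measurable_integral_snd (mh1 i)).
  - by move=> x _; exact: integral_ge0.
  - by apply: measurable_funTS; exact: (measurable_integral_snd (mh2 i)).
  by apply: leeD.
rewrite (_ : 2 * k%:R ^+ 2 / kappa / m = rho^-1 * (k%:R * 2 / m)); last first.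
  by rewrite /rho invf_div; field; rewrite ?gt_eqF.
by rewrite EFinM -muleA lee_pdivlMl// (le_trans rhoF).
Qed.

End HalfLine.

(** * Constant steps and steps proportional to [phi] *)

Section Phi.
Variable R : realType.
Implicit Types (x u d c : R).

Lemma phi_ge0 x : 0 <= phi x. Proof. exact: sqrtr_ge0. Qed.

Lemma phi_sqr x : `|x| <= 1 -> phi x ^+ 2 = 1 - x ^+ 2.
Proof.
move=> x1; rewrite sqr_sqrtr// subr_ge0 -real_normK ?num_real//.
by rewrite expr_le1.
Qed.

Lemma phi_gt0 x : `|x| < 1 -> 0 < phi x.
Proof.
move=> x1; rewrite sqrtr_gt0 subr_gt0 -real_normK ?num_real//.
by rewrite expr_lt1.
Qed.

Lemma phi_opp x : phi (- x) = phi x.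
Proof. by rewrite /phi sqrrN. Qed.

Lemma measurable_phi : measurable_fun setT (@phi R).
Proof.
apply: (@measurableT_comp _ _ _ _ _ _ (@Num.sqrt R) _ (fun x : R => 1 - x ^+ 2)).
  apply: continuous_measurable_fun; exact: sqrt_continuous.
by apply: measurable_funB => //; exact: measurable_funX.
Qed.

(** The last bound says that [d * phi] has slope at most 1, as the derivative of [phi] is
    [- x / phi x]. It follows from multiplying the second bound by [1 + |x|] and using
    [phi x ^ 2 = (1 - |x|) * (1 + |x|)]. *)
Lemma DdeltaP d x : 0 <= d -> Ddelta d x ->
  [/\ `|x| < 1, d * phi x / 2 <= 1 - `|x| & d * `|x| <= phi x].
Proof.
move=> d0 [/= xd x1].
have xle : `|x| <= 1.
  by apply: (le_trans xd); rewrite gerBl divr_ge0// mulr_ge0// phi_ge0.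
have xlt : `|x| < 1.
  rewrite lt_neqAle xle andbT; apply/negP => /eqP x1'; apply: x1.
  have [x0|x0] := lerP 0 x.
    by right; rewrite -x1' ger0_norm.
  by left; rewrite -x1' ltr0_norm// opprK.
have p0 := phi_gt0 xlt.
have pE : phi x ^+ 2 = (1 - `|x|) * (1 + `|x|).
  by rewrite (phi_sqr xle) -[x ^+ 2]real_normK ?num_real//; ring.
have dp : d * phi x / 2 <= 1 - `|x| by lra.
split => //; rewrite -(ler_pM2r p0) -expr2 pE.
have n0 : 0 <= `|x| by [].
have : d * phi x / 2 * (1 + `|x|) <= (1 - `|x|) * (1 + `|x|).
  by apply: ler_wpM2r => //; lra.
have : 0 <= d * phi x / 2 * (1 - `|x|).
  by apply: mulr_ge0; [rewrite divr_ge0// mulr_ge0// ltW|rewrite subr_ge0].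
nra.
Qed.

(** [phi x ^ 2 - phi x' ^ 2 = x' ^ 2 - x ^ 2], divided by [phi x + phi x' >= d * (|x| + |x'|)]. *)
Lemma phi_lip_Ddelta d x x' : 0 <= d -> Ddelta d x -> Ddelta d x' ->
  d * `|phi x - phi x'| <= `|x - x'|.
Proof.
move=> d0 Dx Dx'; have [x1 _ dx] := DdeltaP d0 Dx; have [x1' _ dx'] := DdeltaP d0 Dx'.
have pp : 0 < phi x + phi x' by rewrite addr_gt0// phi_gt0.
have E : `|phi x - phi x'| * (phi x + phi x') = `|x - x'| * `|x + x'|.
  rewrite -{1}(gtr0_norm pp) -!normrM -!subr_sqr.
  by rewrite !phi_sqr ?ltW// distrC; congr `|_|; ring.
rewrite -(ler_pM2r pp) -mulrA E mulrCA; apply: ler_wpM2l => //.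
apply: (@le_trans _ _ (d * (`|x| + `|x'|))).
  by apply: ler_wpM2l => //; exact: ler_normD.
by rewrite mulrDr lerD.
Qed.

(** A perturbation of the identity by a map of Lipschitz constant 1/2. With [d = k * h] and
    [c = i / k - 1 / 2] these are the nodes of the central difference of step [h * phi x]. *)
Lemma expanding_node d c : 0 <= d -> `|c| <= 2^-1 ->
  expanding 2^-1 (Ddelta d) (fun x => x + c * (d * phi x)).
Proof.
move=> d0 c2 x x' Dx Dx'; have L := phi_lip_Ddelta d0 Dx Dx'.
rewrite (_ : x + c * (d * phi x) - (x' + c * (d * phi x')) =
   (x - x') - (- (c * (d * (phi x - phi x'))))); last by ring.
apply: le_trans (lerB_dist _ _); rewrite normrN !normrM (ger0_norm d0).
have : `|c| * (d * `|phi x - phi x'|) <= 2^-1 * `|x - x'|.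
  by apply: ler_pM => //; exact: mulr_ge0.
lra.
Qed.

Lemma measurable_Ddelta d : measurable (Ddelta d).
Proof.
apply: measurableD; last first.
  by apply: measurableU; exact: measurable_set1.
have mf : measurable_fun setT (fun x : R => 1 - d * phi x / 2 - `|x|).
  apply: measurable_funB; last exact: normr_measurable.
  apply: measurable_funB => //; apply: measurable_funM => //.
  by apply: measurable_funM => //; exact: measurable_phi.
have := mf measurableT `[0, +oo[%classic (measurable_itv _).
rewrite setTI; congr measurable; apply/seteqP; split=> x /=;
  by rewrite in_itv/= andbT subr_ge0.
Qed.

End Phi.

(** * Passage between constant and variable steps on the half-line *)

Section Comparison.
Variables (R : realType) (k : nat) (G v : R -> R).
Local Notation mu := (@lebesgue_measure R).
Hypotheses (k0 : (0 < k)%N) (mG : measurable_fun setT G) (mv : measurable_fun setT v).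
Hypotheses (v0 : forall u, 0 <= v u)
  (vm : forall u u' : R, 0 <= u -> u <= u' -> v u <= v u').
Implicit Types (Phi : R -> \bar R) (M : \bar R).

Let kR0 : 0 < k%:R :> R. Proof. by rewrite ltr0n. Qed.
Let kR1 : 1 <= k%:R :> R. Proof. by rewrite ler1n. Qed.
Let mI (a b : R) : measurable (`[a, b]%classic : set R).
Proof. exact: measurable_itv. Qed.
Let mJ (a b : R) : measurable (`]a, b]%classic : set R).
Proof. exact: measurable_itv. Qed.

(* [phi] at distance [u] from an endpoint of [-1, 1]; [phi] is even, so either one. *)
Definition psi (u : R) := phi (u - 1).

Lemma measurable_psi : measurable_fun setT psi.
Proof. by apply: measurableT_comp; [exact: measurable_phi|exact: measurable_funB]. Qed.

Lemma psi_sqr u : 0 <= u <= 1 -> psi u ^+ 2 = u * (2 - u).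
Proof. by move=> u01; rewrite /psi phi_sqr; [ring|rewrite ler_norml; lra]. Qed.

(* The part of [Ddelta (k * h)] within distance [T] of an endpoint, in terms of that
   distance. *)
Definition near_end (T h : R) : set R :=
  [set u | 0 < u <= T /\ k%:R * h * psi u / 2 <= u].

Lemma measurable_near_end T h : measurable (near_end T h).
Proof.
have mf : measurable_fun setT (fun u : R => u - k%:R * h * psi u / 2).
  apply: measurable_funB => //; apply: measurable_funM => //.
  by apply: measurable_funM => //; exact: measurable_psi.
have := mf measurableT `[0, +oo[%classic (measurable_itv _).
rewrite setTI => /(measurableI _ _ (mJ 0 T)); congr measurable.
by apply/seteqP; split=> u /=; rewrite !in_itv/= andbT subr_ge0.
Qed.

Lemma near_end_Ddelta T h u : T <= 1 -> near_end T h u -> Ddelta (k%:R * h) (u - 1).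
Proof.
move=> T1 [/andP[u0 uT] /= ub]; split=> /=.
  by rewrite ler0_norm; rewrite /psi in ub; lra.
by move=> [|] ?; lra.
Qed.

Lemma expanding_near_end T h c : T <= 1 -> 0 <= h -> `|c| <= 2^-1 ->
  expanding 2^-1 (near_end T h) (fun u => u + c * (k%:R * h * psi u)).
Proof.
move=> T1 h0 c2 u u' /(near_end_Ddelta T1) Du /(near_end_Ddelta T1) Du'.
have kh0 : 0 <= k%:R * h by rewrite mulr_ge0.
have := expanding_node kh0 c2 Du Du'.
rewrite (_ : u - 1 - (u' - 1) = u - u'); last by ring.
by rewrite (_ : u - 1 + _ - (u' - 1 + _) =
  u + c * (k%:R * h * psi u) - (u' + c * (k%:R * h * psi u')))//; rewrite /psi; ring.
Qed.

Lemma bounded_steps_integral Phi kappa L M : gauge Phi -> 0 < kappa -> (0 <= M)%E ->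
  bounded_steps k G v Phi kappa L M ->
  (\int[mu]_(tau in `]0%R, kappa]) \int[mu]_(u in `[0%R, L]) Phi (wfd k G v tau u) <=
   kappa%:E * M)%E.
Proof.
move=> gP kap0 M0 H; have [_ P0 _] := gP.
apply: (@le_trans _ _ (\int[mu]_(tau in `]0%R, kappa]) M)%E).
  apply: ge0_le_integral => //.
  - by move=> tau _; apply: integral_ge0 => u _; exact: P0.
  - apply: measurable_funTS.
    apply: (@measurable_integral_snd _ (fun p => Phi (wfd k G v p.1 p.2))) => //.
    exact: measurable_gauge_wfd2.
  by move=> tau /=; rewrite in_itv/= => /andP[t0 tk]; exact: H.
rewrite integral_cst// [X in (_ * X)%E](_ : _ = kappa%:E); first by rewrite muleC.
by apply: (etrans (lebesgue_measure_itv _)); rewrite /= lte_fin kap0 -EFinB subr0.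
Qed.

(** Averaging with [eta u = h * psi u] bounds the variable-step differences by a double integral
    over constant steps, which the hypothesis controls for each step. *)
Lemma variable_steps_le Phi (t h : R) M : gauge Phi -> (0 <= M)%E ->
  let T := 2 * k%:R ^+ 2 * t ^+ 2 in
  T <= 1 -> 0 < h -> h <= t -> bounded_steps k G v Phi T (12 * T) M ->
  (\int[mu]_(u in near_end T h)
    Phi (wfd k G v (h * psi u) (u - k%:R * (h * psi u) / 2) / 2 ^+ k.+1 / 2 ^+ k)%R <=
   (8 * k%:R ^+ 2 * k.+1%:R)%:E * M)%E.
Proof.
move=> gP M0 T T1 h0 ht H.
have t0 : 0 < t by rewrite (lt_le_trans h0).
have T0 : 0 < T by rewrite /T !mulr_gt0 ?exprn_gt0.
(* [kappa = 2 * k * t ^ 2] bounds the steps [h * psi u] for [u <= T]. Since [k * kappa = T], the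
   doubling and the averaging each shorten the range by [T]: from [12 * T] to [11 * T], then
   [10 * T]. *)
pose kappa := T / k%:R.
have kap0 : 0 < kappa by rewrite divr_gt0.
have kkap : k%:R * kappa = T by rewrite mulrC divfK// gt_eqF.
have kapT : kappa <= T by rewrite -kkap ler_peMl// ltW.
have H1 : bounded_steps k G v Phi kappa (11 * T + k%:R * kappa) M.
  move=> s s0 sk; rewrite kkap (_ : 11 * T + T = 12 * T); last by ring.
  by apply: H => //; exact: le_trans kapT.
have g2 : gauge (fun y => Phi (y / 2 ^+ k)) by apply: gauge_scale; rewrite ?exprn_gt0.
have T11 : 0 <= 11 * T by rewrite mulr_ge0// ltW.
(* The averaging needs steps up to [2 * kappa], which exceeds [T] when [k = 1]; one doubling
   provides them. *)
have H2 := bounded_steps_double mG mv v0 vm gP kap0 T11 M0 H1.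
have M1 : (0 <= k.+1%:R%:E * M)%E by rewrite mule_ge0// lee_fin.
have kap20 : 0 < 2 * kappa by rewrite mulr_gt0.
have H3 := bounded_steps_integral g2 kap20 M1 H2.
have HH := @integral_averaging_le R k G v k0 mG mv v0 vm _ kappa (10 * T) 2^-1
  (near_end T h) (fun u => u - k%:R * (h * psi u) / 2) (fun u => h * psi u) g2 kap0.
rewrite kkap (_ : 10 * T + T = 11 * T) in HH; last by ring.
have mhp : measurable_fun setT (fun u => h * psi u).
  by apply: measurable_funM => //; exact: measurable_psi.
apply: (le_trans (HH _ _ (measurable_near_end _ _) _ mhp _ _)).
- by rewrite mulr_ge0// ltW.
- by rewrite invr_gt0.
- by apply: measurable_funB => //; apply: measurable_funM => //; exact: measurable_funM.
- move=> u [/andP[u0 uT] ub].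
  have p0 : 0 <= psi u by exact: phi_ge0.
  have hp0 : 0 <= h * psi u by rewrite mulr_ge0// ltW.
  have kh0 : 0 <= k%:R * (h * psi u) by rewrite mulr_ge0// ltW.
  split => //; [by rewrite mulrA; lra|by lra|].
  have pb : psi u <= 2 * k%:R * t.
    rewrite -(@ler_pXn2r _ 2)// ?nnegrE//; last by rewrite !mulr_ge0// ltW.
    rewrite psi_sqr; last by apply/andP; split; lra.
    rewrite (_ : (2 * k%:R * t) ^+ 2 = 2 * T); last by rewrite /T; ring.
    by nra.
  rewrite (_ : kappa = t * (2 * k%:R * t)); last first.
    by rewrite /kappa /T; field; rewrite gt_eqF.
  by apply: ler_pM => //; exact: ltW.
- move=> i ik x x' Xx Xx'.
  have c2 : `|i%:R / k%:R - 2^-1| <= 2^-1 :> R.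
    have i0 : 0 <= i%:R / k%:R :> R by rewrite divr_ge0.
    have i1 : i%:R / k%:R <= 1 :> R by rewrite ler_pdivrMr// mul1r ler_nat.
    by rewrite ler_norml; lra.
  have := expanding_near_end T1 (ltW h0) c2 Xx Xx'.
  congr (_ <= `|_ - _|).
    by field; rewrite gt_eqF.
  by field; rewrite gt_eqF.
apply: (@le_trans _ _ ((2 * k%:R ^+ 2 / kappa / 2^-1)%:E *
  ((2 * kappa)%:E * (k.+1%:R%:E * M))))%E.
  apply: lee_wpmul2l => //; rewrite lee_fin !divr_ge0 ?mulr_ge0 ?exprn_ge0 ?invr_ge0// ltW//.
rewrite !muleA -!EFinM.
rewrite (_ : 2 * k%:R ^+ 2 / kappa / 2^-1 * (2 * kappa) * k.+1%:R =
  8 * k%:R ^+ 2 * k.+1%:R)//.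
by field; rewrite gt_eqF.
Qed.

(* [n] doublings lead from the steps [kappa = k t^2 / 4], reached by [h <= t], to all
   steps up to [2 k^2 t^2 = 8 k kappa <= 2^n kappa]; [end_const * t^2] is how far from
   the endpoint the base points and nodes then reach. *)
Let n := (8 * k)%N.
Definition end_const : R := 24 * k%:R ^+ 2 + 2 ^+ n * k%:R ^+ 2 / 4 + k%:R ^+ 2 / 2.

(** The first node [u] is replaced by the centre [x = u + k * tau / 2]; then, for fixed [x],
    [tau = h * psi x] turns constant steps into variable ones. The Jacobian [psi x] and the length
    of the range of [h] are both of order [t], whence the factor [t ^ 2]. *)
Lemma integral_steps_le Phi (t kappa X : R) M : gauge Phi -> (0 <= M)%E ->
  0 < t -> kappa = k%:R * t ^+ 2 / 4 -> k%:R * kappa <= X -> X <= 2^-1 ->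
  X <= end_const * t ^+ 2 ->
  (forall h : R, 0 < h -> h <= t -> (\int[mu]_(u in near_end 2^-1 h)
    Phi (wfd k G v (h * psi u) (u - k%:R * (h * psi u) / 2))%R <= M)%E) ->
  (\int[mu]_(tau in `]0%R, (2 * kappa)%R])
     \int[mu]_(u in `[0%R, (X - k%:R * kappa)%R]) Phi (wfd k G v tau u) <=
   ((1 + 2 * end_const) * t ^+ 2)%:E * M)%E.
Proof.
move=> gP M0 t0 kapE kX X1 XL H; have [mPhi P0 Pm] := gP.
have t20 : 0 < t ^+ 2 by rewrite exprn_gt0.
have kap0 : 0 < kappa by rewrite kapE divr_gt0// mulr_gt0.
have X0 : 0 < X by apply: lt_le_trans kX; exact: mulr_gt0.
have L0 : 0 < end_const.
  by rewrite /end_const !addr_gt0// ?divr_gt0// ?mulr_gt0// ?exprn_gt0.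
(* A bound for [psi x] on []0, X]], where [psi x ^ 2 <= 2 * end_const * t ^ 2]; the cruder factor
   [1 + 2 * end_const] avoids a square root. *)
pose b := (1 + 2 * end_const) * t.
have b0 : 0 < b by rewrite mulr_gt0// addr_gt0// mulr_gt0.
pose g (p : R * R) := Phi (wfd k G v p.1 (p.2 - k%:R * p.1 / 2)).
(* Pairs of a step and a centre for which the first node has not passed the endpoint. *)
pose E := [set p : R * R | k%:R * p.1 / 2 <= p.2].
have mz : measurable_fun setT (fun p : R * R => p.2 - k%:R * p.1 / 2).
  apply: measurable_funB => //; apply: measurable_funM => //.
  exact: measurable_funM.
have mg : measurable_fun setT g.
  have mpair : measurable_fun setT (fun p : R * R => (p.1, p.2 - k%:R * p.1 / 2)).
    exact: measurable_fun_pair.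
  exact: (measurableT_comp (measurable_gauge_wfd2 k mG mv gP) mpair).
have mE : measurable E.
  have := mz measurableT `[0, +oo[%classic (measurable_itv _).
  rewrite setTI; congr measurable; apply/seteqP; split=> p /=;
    by rewrite in_itv/= andbT subr_ge0.
pose hh := g \_ E.
have mhh : measurable_fun setT hh.
  by apply/(measurable_restrictT _ mE); exact: measurable_funTS.
have hh0 p : (0 <= hh p)%E by rewrite /hh patchE; case: ifP => // _; exact: P0.
have mpsi := measurable_psi.
have mhp : measurable_fun setT (fun p : R * R => hh (p.2 * psi p.1, p.1)).
  apply: (measurableT_comp mhh); apply: measurable_fun_pair => //.
  by apply: measurable_funM => //; exact: measurableT_comp.
have psib x : 0 < x -> x <= X -> 0 < psi x /\ psi x <= b.
  move=> x0 xX; have x1 : 0 <= x <= 1 by apply/andP; split; lra.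
  split.
    by apply: phi_gt0; rewrite ltr_norml; lra.
  have p0 : 0 <= psi x by exact: phi_ge0.
  rewrite -(@ler_pXn2r _ 2)// ?nnegrE ?(ltW b0)// psi_sqr//.
  have : x * (2 - x) <= 2 * end_const * t ^+ 2 by nra.
  by move=> /le_trans; apply; rewrite /b exprMn ler_pM2r//; nra.
apply: (@le_trans _ _ (\int[mu]_(tau in `]0%R, (2 * kappa)%R])
    \int[mu]_(x in `]0%R, X]) hh (tau, x))%E).
  apply: ge0_le_integral => //.
  - by move=> tau _; apply: integral_ge0 => u _; exact: P0.
  - apply: measurable_funTS.
    apply: (@measurable_integral_snd _ (fun p => Phi (wfd k G v p.1 p.2))) => //.
    exact: measurable_gauge_wfd2.
  - by apply: measurable_funTS; apply: measurable_integral_snd.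
  move=> tau /=; rewrite in_itv/= => /andP[tau0 tauk].
  have kt0 : 0 < k%:R * tau / 2 by rewrite divr_gt0// mulr_gt0.
  have ktk : k%:R * tau / 2 <= k%:R * kappa by rewrite -mulrA ler_pM2l//; lra.
  rewrite (@eq_integral _ _ _ mu `[0, X - k%:R * kappa]%classic
    (fun u => hh (tau, u + k%:R * tau / 2))); last first.
    move=> u; rewrite inE/= in_itv/= => /andP[u0 uL].
    rewrite /hh patchE mem_set; last by rewrite /E/=; lra.
    by rewrite /g/= addrK.
  have := @ge0_integral_expanding R 1 `[0, X - k%:R * kappa]%classic `]0, X]%classic
    (fun u => u + k%:R * tau / 2) (fun x => hh (tau, x)).
  rewrite invr1 mul1e; apply => //.
  - exact: measurable_funD.
  - by move=> x x' _ _; rewrite mul1r (_ : x + _ - _ = x - x')//; ring.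
  - by move=> u /=; rewrite !in_itv/= => /andP[u0 uL]; apply/andP; split; lra.
  - by apply: measurableT_comp.
rewrite tonelli_on//.
apply: (@le_trans _ _ (\int[mu]_(x in `]0%R, X])
    (b%:E * \int[mu]_(h in `]0%R, t]) hh (h * psi x, x)%R))%E).
  apply: ge0_le_integral => //.
  - by move=> x _; exact: integral_ge0.
  - by apply: measurable_funTS; apply: measurable_integral_fst.
  - apply: measurable_funTS; apply: measurable_funeM.
    exact: (@measurable_integral_snd _ (fun p => hh (p.2 * psi p.1, p.1))).
  move=> x /=; rewrite in_itv/= => /andP[x0 xX].
  have [p0 pb] := psib x x0 xX.
  (* The integrand vanishes off [E], where moreover [h = tau / psi x] could exceed [t]. *)
  pose S := `]0, 2 * kappa]%classic `&` [set tau | E (tau, x)].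
  have mS : measurable S.
    apply: measurableI => //; rewrite (_ : [set _ | _] = (fun tau => (tau, x)) @^-1` E)//.
    by rewrite -[_ @^-1` _]setTI; apply: measurable_pair2.
  rewrite (_ : (\int[mu]_(tau in `]0%R, (2 * kappa)%R]) hh (tau, x) =
    \int[mu]_(tau in S) hh (tau / psi x * psi x, x)%R)%E); last first.
    rewrite /S [RHS]integral_mkcondr; apply: eq_integral => tau _.
    rewrite patchE; case: ifPn => [_|]; first by rewrite divfK ?gt_eqF.
    by rewrite notin_setE /= => nE; rewrite /hh patchE memNset.
  apply: (@le_trans _ _ ((psi x)%:E * \int[mu]_(h in `]0%R, t]) hh (h * psi x, x)%R)%E);
    last by apply: lee_wpmul2r; [exact: integral_ge0|rewrite lee_fin].
  have := @ge0_integral_expanding R (psi x)^-1 S `]0, t]%classic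
    (fun tau => tau / psi x) (fun h => hh (h * psi x, x)).
  rewrite invrK; apply => //.
  - by rewrite invr_gt0.
  - exact: measurable_funM.
  - by move=> s s' _ _; rewrite -mulrBl normrM [`|(psi x)^-1|]gtr0_norm ?invr_gt0// mulrC.
  - move=> tau [/=]; rewrite !in_itv/= => /andP[tau0 tauk].
    rewrite /E/= => kx; rewrite divr_gt0//= ler_pdivrMr//.
    have tp : 0 <= t * psi x by rewrite mulr_ge0// ltW.
    have x01 : 0 <= x <= 1 by apply/andP; split; lra.
    rewrite -(@ler_pXn2r _ 2)// ?nnegrE ?(ltW tau0)// exprMn (psi_sqr x01).
    (* This gives [h <= t]: [tau <= k * t ^ 2 / 2] and [k * tau / 2 <= x] yield
       [tau ^ 2 <= t ^ 2 * x], and [x <= x * (2 - x) = psi x ^ 2]. *)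
    have : tau ^+ 2 <= t ^+ 2 * x.
      have : tau * tau <= k%:R * t ^+ 2 / 2 * tau by rewrite ler_pM2r//; lra.
      have : t ^+ 2 * (k%:R * tau / 2) <= t ^+ 2 * x by rewrite ler_pM2l.
      by rewrite expr2; lra.
    by move=> /le_trans; apply; apply: ler_wpM2l; [exact: ltW|nra].
  - have mpair : measurable_fun setT (fun h : R => (h * psi x, x)).
      by apply: measurable_fun_pair => //; exact: measurable_funM.
    exact: (measurableT_comp mhh mpair).
rewrite ge0_integralZl//; first last.
- by rewrite lee_fin ltW.
- by move=> x _; exact: integral_ge0.
- apply: measurable_funTS.
  exact: (@measurable_integral_snd _ (fun p => hh (p.2 * psi p.1, p.1))).
rewrite (_ : (1 + 2 * end_const) * t ^+ 2 = b * t); last by rewrite /b; ring.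
rewrite (EFinM b t) -muleA; apply: lee_wpmul2l; first by rewrite lee_fin ltW.
rewrite (@tonelli_on _ (fun p => hh (p.2 * psi p.1, p.1)))//=.
apply: (@le_trans _ _ (\int[mu]_(h in `]0%R, t]) M)%E).
  apply: ge0_le_integral => //.
  - by move=> h _; exact: integral_ge0.
  - apply: measurable_funTS.
    exact: (@measurable_integral_fst _ (fun p => hh (p.2 * psi p.1, p.1))).
  move=> h /=; rewrite in_itv/= => /andP[h0 ht].
  apply: le_trans (H h h0 ht).
  pose F x := g (h * psi x, x).
  have mF : measurable_fun setT F.
    have mpair : measurable_fun setT (fun x : R => (h * psi x, x)).
      by apply: measurable_fun_pair => //; exact: measurable_funM.
    exact: (measurableT_comp mg mpair).
  (* At [tau = h * psi x] the condition [E] is the one in [near_end]. *)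
  rewrite (_ : (\int[mu]_(x in `]0%R, X]) hh (h * psi x, x)%R =
    \int[mu]_(x in near_end X h) F x)%E); last first.
    rewrite (_ : near_end X h = `]0, X]%classic `&` [set x | E (h * psi x, x)]).
      rewrite [RHS]integral_mkcondr; apply: eq_integral => x _.
      rewrite patchE; case: ifPn; first by rewrite inE/= => Ex; rewrite /hh patchE mem_set.
      by rewrite notin_setE /= => nE; rewrite /hh patchE memNset.
    by apply/seteqP; split=> u /=; rewrite in_itv/= /E/= mulrA.
  apply: (@ge0_subset_integral _ _ _ mu (near_end X h) (near_end 2^-1 h)).
  - exact: measurable_near_end.
  - exact: measurable_near_end.
  - exact: measurable_funTS.
  - by move=> x _; exact: P0.
  - by move=> u [/andP[u0 uX] uh]; split=> //; rewrite u0 (le_trans uX).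
rewrite integral_cst// [X in (_ * X)%E](_ : _ = t%:E); first by rewrite muleC.
by apply: (etrans (lebesgue_measure_itv _)); rewrite /= lte_fin t0 -EFinB subr0.
Qed.

(** Steps up to [kappa = k * t ^ 2 / 4] are handled by averaging followed by [integral_steps_le];
    iterated doubling then reaches all steps up to [T]. *)
Lemma constant_steps_le Phi (t : R) M : gauge Phi -> (0 <= M)%E -> 0 < t ->
  end_const * t ^+ 2 <= 2^-1 ->
  let T := 2 * k%:R ^+ 2 * t ^+ 2 in
  (forall h : R, 0 < h -> h <= t -> (\int[mu]_(u in near_end 2^-1 h)
    Phi (wfd k G v (h * psi u) (u - k%:R * (h * psi u) / 2))%R <= M)%E) ->
  bounded_steps k G v (fun y => Phi (y / 2 ^+ (k * n) / 2 ^+ k.+1)) T (12 * T)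
    ((k.+1%:R ^+ n * (8 * k%:R * (1 + 2 * end_const)))%:E * M).
Proof.
move=> gP M0 t0 L1 T H; have [mPhi P0 Pm] := gP.
have t20 : 0 < t ^+ 2 by rewrite exprn_gt0.
have T0 : 0 < T by rewrite /T !mulr_gt0 ?exprn_gt0.
pose kappa := k%:R * t ^+ 2 / 4.
have kap0 : 0 < kappa by rewrite divr_gt0// mulr_gt0.
have L0 : 0 < end_const.
  by rewrite /end_const !addr_gt0// ?divr_gt0// ?mulr_gt0// ?exprn_gt0.
have g2 : gauge (fun y => Phi (y / 2 ^+ k.+1)) by apply: gauge_scale; rewrite ?exprn_gt0.
pose X := end_const * t ^+ 2.
(* [L] leaves room for the doublings. Up to [X] there remain [k * kappa] for the averaging and
   [k * kappa] for passing from first nodes to centres. *)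
pose L := 12 * T + k%:R * (2 ^+ n * kappa).
have XL : X = L + k%:R * kappa + k%:R * kappa.
  by rewrite /X /L /end_const /T /kappa; field.
have n2k : 0 < 2 ^+ n * kappa by rewrite mulr_gt0 ?exprn_gt0.
have L'0 : 0 <= L by rewrite addr_ge0// ?mulr_ge0// ltW.
have kX : k%:R * kappa <= X.
  by rewrite XL lerDr addr_ge0// mulr_ge0// ltW.
have HA := integral_steps_le gP M0 t0 (erefl kappa) kX L1 (lexx _) H.
rewrite (_ : X - k%:R * kappa = L + k%:R * kappa) in HA; last by rewrite XL; ring.
have H1 : bounded_steps k G v (fun y => Phi (y / 2 ^+ k.+1)) kappa L
    ((8 * k%:R * (1 + 2 * end_const))%:E * M).
  move=> s s0 sk.
  have ms : measurable_fun setT (cst s : R -> R) by [].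
  (* With a constant step the node maps are translations, so [m = 1]. *)
  have := @integral_averaging_le R k G v k0 mG mv v0 vm Phi kappa L 1
    `[0, L]%classic id (cst s) gP kap0 L'0 ltr01 (mI _ _) _ ms.
  move=> HH; apply: (le_trans (HH _ _ _)) => //.
  - move=> x /=; rewrite in_itv/= => /andP[x0 xL]; split => //; exact: ltW.
  - by move=> i _ x x' _ _; rewrite /= mul1r (_ : x + _ - _ = x - x')//; ring.
  apply: (@le_trans _ _ ((2 * k%:R ^+ 2 / kappa / 1)%:E *
     (((1 + 2 * end_const) * t ^+ 2)%:E * M)))%E.
    apply: lee_wpmul2l => //; rewrite lee_fin divr1 divr_ge0 ?mulr_ge0 ?exprn_ge0// ltW//.
  rewrite muleA -EFinM (_ : 2 * k%:R ^+ 2 / kappa / 1 * _ = 8 * k%:R * (1 + 2 * end_const))//.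
  by rewrite /kappa; field; rewrite !gt_eqF.
have C0 : (0 <= (8 * k%:R * (1 + 2 * end_const))%:E * M)%E.
  by rewrite mule_ge0// lee_fin !mulr_ge0 ?ltW// addr_gt0// mulr_gt0.
have T12 : 0 <= 12 * T by rewrite mulr_ge0// ltW.
have := bounded_steps_iter mG mv v0 vm g2 kap0 T12 C0 H1.
rewrite muleA -EFinM => H2 s s0 sT; apply: H2 => //; apply: (le_trans sT).
rewrite (_ : T = 8 * k%:R * kappa); last by rewrite /T /kappa; field.
rewrite ler_pM2r// -natrM -natrX ler_nat.
exact/ltnW/ltn_expl.
Qed.

End Comparison.

(** * Transfer from the half-line to an endpoint of [-1, 1] *)

Section Endpoint.
Variables (R : realType) (k : nat) (g w : R -> R) (W : R -> R -> R) (e a c : R).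
Local Notation mu := (@lebesgue_measure R).
Hypotheses (k0 : (0 < k)%N) (mg : measurable_fun setT g) (mw : measurable_fun setT w).
Hypotheses (mW : forall h, measurable_fun setT (W h)).
Hypotheses (w0 : forall x, 0 <= w x) (W0 : forall h x, 0 <= W h x).
(* [x = e * (u - 1)] is the point of [-1, 1] at distance [u] from the endpoint [- e];
   [e = 1] is the left endpoint, [e = -1] the right one. *)
Hypotheses (e1 : e = 1 \/ e = -1) (a0 : 0 <= a) (c1 : 1 <= c).
Hypotheses (wv : forall u, 0 <= u <= 1 ->
  u `^ a <= w (e * (u - 1)) /\ w (e * (u - 1)) <= c * u `^ a).
Hypotheses (Wv : forall h u, 0 < h -> near_end k 1 h u ->
  W h (e * (u - 1)) <= c * (u - k%:R * (h * psi u) / 2) `^ a).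
Hypotheses (vW : forall h u, 0 < h -> near_end k 2^-1 h u ->
  (u - k%:R * (h * psi u) / 2) `^ a <= W h (e * (u - 1))).
Implicit Types (Phi : R -> \bar R) (M : \bar R).

Let ee : e * e = 1. Proof. by case: e1 => ->; ring. Qed.
Let normre : `|e| = 1. Proof. by case: e1 => ->; rewrite ?normrN normr1. Qed.
Let G u := g (e * (u - 1)).
Let v u : R := u `^ a.

Let mchart : measurable_fun setT (fun u : R => e * (u - 1)).
Proof. by apply: measurable_funM => //; exact: measurable_funB. Qed.
Let mdist : measurable_fun setT (fun x : R => 1 + e * x).
Proof. by apply: measurable_funD => //; exact: measurable_funM. Qed.
Let mG : measurable_fun setT G.
Proof. exact: (measurableT_comp mg mchart). Qed.
Let mv : measurable_fun setT v. Proof. exact: measurable_powR. Qed.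
Let v0 u : 0 <= v u. Proof. exact: powR_ge0. Qed.
Let vm u u' : 0 <= u -> u <= u' -> v u <= v u'.
Proof. by move=> u0 uu'; rewrite ge0_ler_powR ?nnegrE// (le_trans u0). Qed.

Let exchart X : expanding 1 X (fun u : R => e * (u - 1)).
Proof.
move=> u u' _ _; rewrite mul1r (_ : e * (u - 1) - e * (u' - 1) = e * (u - u')); last by ring.
by rewrite normrM normre mul1r.
Qed.
Let exdist X : expanding 1 X (fun x : R => 1 + e * x).
Proof.
move=> x x' _ _; rewrite mul1r (_ : 1 + e * x - (1 + e * x') = e * (x - x')); last by ring.
by rewrite normrM normre mul1r.
Qed.
Let chartK x : e * (1 + e * x - 1) = x.
Proof. by rewrite addrC addrA addNr add0r mulrA ee mul1r. Qed.
Let distK u : 1 + e * (e * (u - 1)) = u.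
Proof. by rewrite mulrA ee mul1r addrC subrK. Qed.
Let psi_chart u : phi (e * (u - 1)) = psi u.
Proof. by case: e1 => ->; rewrite ?mul1r ?mulN1r ?phi_opp. Qed.

(** At the right endpoint the chart reverses orientation, under which a central difference changes
    at most its sign. *)
Lemma norm_fd_center s u :
  `|fd k s g (e * (u - 1) - k%:R * s / 2)| = `|fd k s G (u - k%:R * s / 2)|.
Proof.
case: e1 => eE.
  rewrite /fd; congr `|_|; apply: eq_bigr => i _; rewrite /G eE; congr (_ * g _); ring.
rewrite (_ : G = fun u => g (1 - u)); last by apply/funext => z; rewrite /G eE; congr g; ring.
rewrite fd_reflect normrM normrX normrN1 expr1n mul1r eE.
by congr `|fd k s g _|; field.
Qed.

(** The central difference of step [h * phi x] written from its first node, free of the domain test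
    of [Delta]. *)
Definition cdiff h x : R := fd k (h * phi x) g (x - k%:R * (h * phi x) / 2).

Definition endset (T : R) : set R := [set x | 0 <= 1 + e * x <= T].

Lemma measurable_endset T : measurable (endset T).
Proof.
have := mdist measurableT (measurable_itv `[0, T]).
by rewrite setTI; congr measurable; apply/seteqP; split=> x /=; rewrite in_itv/=.
Qed.

Lemma measurable_cdiff h : measurable_fun setT (cdiff h).
Proof.
have mp := @measurable_phi R.
have m1 : measurable_fun setT (fun x : R => h * phi x) by exact: measurable_funM.
have mpair : measurable_fun setT (fun x : R => (h * phi x, x - k%:R * (h * phi x) / 2)).
  apply: measurable_fun_pair => //; apply: measurable_funB => //.
  by apply: measurable_funM => //; exact: measurable_funM.
exact: (measurableT_comp (measurable_fd2 k mg) mpair).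
Qed.

Let measurable_Phi Phi f : gauge Phi -> measurable_fun setT f ->
  measurable_fun setT (fun x : R => Phi (f x)).
Proof. by move=> [mPhi _ _]; exact: measurableT_comp. Qed.

Let mI (x y : R) : measurable (`[x, y]%classic : set R).
Proof. exact: measurable_itv. Qed.

(** [variable_steps_le] read through the chart: [w] dominates [u ^ a], and [W] is at most [c] times
    the weight at the first node. *)
Lemma near_endpoint_cdiff_le Phi (t h : R) M :
  let T := 2 * k%:R ^+ 2 * t ^+ 2 in
  gauge Phi -> (0 <= M)%E -> 12 * T <= 1 -> 0 < h -> h <= t ->
  (forall s, 0 < s -> s <= T ->
    (\int[mu]_(x in endset (12 * T)%R) Phi (w x * `|fd k s G (1 + e * x)|)%R <= M)%E) ->
  (\int[mu]_(x in [set x | near_end k T h (1 + e * x)%R])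
      Phi (W h x * `|cdiff h x| / (c * 2 ^+ k.+1 * 2 ^+ k))%R <=
    (8 * k%:R ^+ 2 * k.+1%:R)%:E * M)%E.
Proof.
move=> T gP M0 T12 h0 ht H; have [mPhi P0 Pm] := gP.
have T0 : 0 <= T by apply: mulr_ge0; [apply: mulr_ge0|]; rewrite ?sqr_ge0.
have T1 : T <= 1 by lra.
have c0 : 0 < c by rewrite (lt_le_trans ltr01).
have HB : bounded_steps k G v Phi T (12 * T) M.
  move=> s s0 sT; apply: le_trans (H s s0 sT).
  apply: (@ge0_le_integral_expanding _ `[0, 12 * T]%classic (endset (12 * T))
    (fun u : R => e * (u - 1))) => //.
  - exact: measurable_endset.
  - by move=> u /=; rewrite in_itv/= /endset/= distK.
  - apply: measurable_Phi => //; apply: measurable_funM => //.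
    apply: measurableT_comp => //; exact: (measurableT_comp (measurable_fd k s mG) mdist).
  - exact: (measurable_gauge_wfd k mG mv gP (eta := cst s) (z := id)).
  move=> u /=; rewrite in_itv/= => /andP[u0 uT]; rewrite distK.
  apply: Pm; first by rewrite mulr_ge0.
  by apply: ler_wpM2r => //; have [] := @wv u; [apply/andP; split; lra|].
apply: le_trans (variable_steps_le k0 mG mv v0 vm gP M0 T1 h0 ht HB).
have mN : measurable (near_end k T h) by exact: measurable_near_end.
have mpre : measurable [set x | near_end k T h (1 + e * x)].
  by rewrite -[X in measurable X]setTI; exact: mdist.
pose F u := Phi (wfd k G v (h * psi u) (u - k%:R * (h * psi u) / 2) / 2 ^+ k.+1 / 2 ^+ k).
have mF : measurable_fun setT F.
  have g2 : gauge (fun y => Phi (y / 2 ^+ k.+1 / 2 ^+ k)).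
    apply: (@gauge_scale _ (fun y => Phi (y / 2 ^+ k))); rewrite ?exprn_gt0//.
    by apply: gauge_scale; rewrite ?exprn_gt0.
  have m1 : measurable_fun setT (fun u : R => h * psi u).
    by apply: measurable_funM => //; exact: measurable_psi.
  apply: (measurable_gauge_wfd k mG mv g2 m1).
  by apply: measurable_funB => //; apply: measurable_funM => //; exact: measurable_funM.
apply: (@ge0_le_integral_expanding _ _ (near_end k T h) (fun x : R => 1 + e * x) F) => //.
- by move=> u; exact: P0.
- apply: measurable_Phi => //.
  apply: measurable_funM => //; apply: measurable_funM => //.
  by apply: measurableT_comp => //; exact: measurable_cdiff.
move=> x /=; set u := 1 + e * x => nu; rewrite -[in W h x](chartK x) -/u.
have -> : `|cdiff h x| = `|fd k (h * psi u) G (u - k%:R * (h * psi u) / 2)|.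
  rewrite -norm_fd_center /cdiff.
  by rewrite -(psi_chart u) (chartK x).
have nu1 : near_end k 1 h u.
  by case: nu => /andP[u0 uT] ub; split=> //; rewrite u0/=; lra.
apply: Pm.
  by rewrite divr_ge0 ?mulr_ge0// ?exprn_ge0// ltW.
rewrite /wfd -[X in _ <= X]mulrA -invfM.
rewrite ler_pdivrMr ?mulr_gt0 ?exprn_gt0//.
rewrite (_ : _ / _ * _ = c * v (u - k%:R * (h * psi u) / 2) *
  `|fd k (h * psi u) G (u - k%:R * (h * psi u) / 2)|).
  by apply: ler_wpM2r => //; exact: Wv.
by field; rewrite !gt_eqF ?exprn_gt0.
Qed.

(** [constant_steps_le] read through the chart: within distance 1/2 of the endpoint [W] dominates
    the weight at the first node, and [c] pays for replacing [u ^ a] by [w]. *)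
Lemma near_endpoint_fd_le Phi (t : R) M :
  let T := 2 * k%:R ^+ 2 * t ^+ 2 in
  gauge Phi -> (0 <= M)%E -> 12 * T <= 1 -> 0 < t -> end_const R k * t ^+ 2 <= 2^-1 ->
  (forall h, 0 < h -> h <= t ->
    (\int[mu]_(x in Ddelta (k%:R * h)%R) Phi (W h x * `|cdiff h x|)%R <= M)%E) ->
  forall s, 0 < s -> s <= T ->
  (\int[mu]_(x in endset (12 * T)%R)
     Phi (w x * `|fd k s G (1 + e * x)| / (c * 2 ^+ (k * (8 * k)) * 2 ^+ k.+1))%R <=
    (k.+1%:R ^+ (8 * k) * (8 * k%:R * (1 + 2 * end_const R k)))%:E * M)%E.
Proof.
move=> T gP M0 T12 t0 tE H s s0 sT; have [mPhi P0 Pm] := gP.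
have c0 : 0 < c by rewrite (lt_le_trans ltr01).
have HB h : 0 < h -> h <= t -> (\int[mu]_(u in near_end k 2^-1 h)
    Phi (wfd k G v (h * psi u) (u - k%:R * (h * psi u) / 2))%R <= M)%E.
  move=> h0 ht; apply: le_trans (H h h0 ht).
  have mN : measurable (near_end k 2^-1 h) by exact: measurable_near_end.
  have mD : measurable (Ddelta (k%:R * h)) by exact: measurable_Ddelta.
  have mF : measurable_fun setT (fun x : R => Phi (W h x * `|cdiff h x|)).
    apply: measurable_Phi => //; apply: measurable_funM => //.
    by apply: measurableT_comp => //; exact: measurable_cdiff.
  apply: (@ge0_le_integral_expanding _ _ _ (fun u : R => e * (u - 1))) => //.
  - move=> u nu; have Du := near_end_Ddelta (_ : 2^-1 <= 1) nu.
    case: e1 => ->; first by rewrite mul1r; apply: Du; lra.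
    rewrite mulN1r; have [] := Du _; first by lra.
    move=> /= D1 D2; split => /=; first by rewrite normrN phi_opp.
    by move=> [|] E; apply: D2; [right|left]; lra.
  - have m1 : measurable_fun setT (fun u : R => h * psi u).
      by apply: measurable_funM => //; exact: measurable_psi.
    apply: (measurable_gauge_wfd k mG mv gP m1).
    by apply: measurable_funB => //; apply: measurable_funM => //; exact: measurable_funM.
  move=> u nu; rewrite /cdiff psi_chart norm_fd_center.
  apply: Pm; first by rewrite mulr_ge0.
  by apply: ler_wpM2r => //; exact: vW.
have := constant_steps_le k0 mG mv v0 vm gP M0 t0 tE HB s0 sT.
apply: le_trans.
have g2 : gauge (fun y => Phi (y / 2 ^+ (k * (8 * k)) / 2 ^+ k.+1)).
  apply: (@gauge_scale _ (fun y => Phi (y / 2 ^+ k.+1))); rewrite ?exprn_gt0//.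
  by apply: gauge_scale; rewrite ?exprn_gt0.
pose F u := Phi (wfd k G v s u / 2 ^+ (k * (8 * k)) / 2 ^+ k.+1).
have mF : measurable_fun setT F.
  exact: (measurable_gauge_wfd k mG mv g2 (eta := cst s) (z := id)).
apply: (@ge0_le_integral_expanding _ _ `[0, 12 * T]%classic (fun x : R => 1 + e * x) F) => //.
- exact: measurable_endset.
- by move=> u; exact: P0.
- apply: measurable_Phi => //.
  apply: measurable_funM => //; apply: measurable_funM => //.
  by apply: measurableT_comp => //; exact: (measurableT_comp (measurable_fd k s mG) mdist).
move=> x /=; rewrite /endset/=; set u := 1 + e * x => /andP[u0 uT].
rewrite -[in w x](chartK x) -/u.
apply: Pm.
  by rewrite divr_ge0 ?mulr_ge0// ?exprn_ge0// ltW.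
rewrite /wfd -[X in _ <= X]mulrA -invfM.
rewrite ler_pdivrMr ?mulr_gt0 ?exprn_gt0//.
rewrite (_ : _ / _ * _ = c * v u * `|fd k s G u|).
  by apply: ler_wpM2r => //; have [] := @wv u; [apply/andP; split; lra|].
by field; rewrite !gt_eqF ?exprn_gt0.
Qed.

End Endpoint.

(** * Jacobi weights *)

Section Weights.
Variable R : realType.
Implicit Types (a b x u h : R) (k : nat).

Lemma powR_ge1 (x a : R) : 1 <= x -> 0 <= a -> 1 <= x `^ a.
Proof. by move=> x1 a0; rewrite -(powRr0 x) ler_powR. Qed.

Lemma jacobi_ge0 a b x : 0 <= jacobi a b x.
Proof. by rewrite mulr_ge0 ?powR_ge0. Qed.

Lemma Wdelta_ge0 d a b x : 0 <= Wdelta d a b x.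
Proof. by rewrite mulr_ge0 ?powR_ge0. Qed.

Lemma measurable_jacobi a b : measurable_fun setT (@jacobi R a b).
Proof.
apply: measurable_funM; apply: (measurableT_comp (measurable_powR _)).
  exact: measurable_funB.
exact: measurable_funD.
Qed.

Lemma measurable_Wdelta d a b : measurable_fun setT (@Wdelta R d a b).
Proof.
have mp : measurable_fun setT (fun x : R => d * phi x / 2).
  by apply: measurable_funM => //; apply: measurable_funM => //; exact: measurable_phi.
apply: measurable_funM; apply: (measurableT_comp (measurable_powR _)).
  by apply: measurable_funB => //; exact: measurable_funB.
by apply: measurable_funB => //; exact: measurable_funD.
Qed.

(** At [-1] and [1] the two sides may differ because of the convention [0 ^ 0 = 1]. *)
Lemma jacobi_phiE a b (r : nat) x : `|x| < 1 ->
  jacobi_phi a b r x = jacobi (r%:R / 2 + a) (r%:R / 2 + b) x.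
Proof.
rewrite ltr_norml => /andP[x1 x2].
have p0 : 0 < 1 - x by lra.
have q0 : 0 < 1 + x by lra.
rewrite /jacobi_phi /jacobi /phi !powRD ?(gt_eqF p0, gt_eqF q0) ?implybT//.
rewrite -powR12_sqrt; last by nra.
rewrite (_ : 1 - x ^+ 2 = (1 - x) * (1 + x)); last by ring.
rewrite -powR_mulrn ?powR_ge0// -powRrM powRM ?ltW// (mulrC 2^-1).
by ring.
Qed.

(** The factor belonging to the far endpoint has base [2 - u], between 1 and 2. *)
Lemma jacobi_endpoint a b u : 0 <= a -> 0 <= b -> 0 <= u <= 1 ->
  u `^ b <= jacobi a b (u - 1) /\ jacobi a b (u - 1) <= 2 `^ (a + b) * u `^ b.
Proof.
move=> a0 b0 /andP[u0 u1]; rewrite /jacobi (_ : 1 - (u - 1) = 2 - u); last by ring.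
rewrite (_ : 1 + (u - 1) = u); last by ring.
split; first by rewrite ler_peMl ?powR_ge0// powR_ge1//; lra.
apply: ler_wpM2r; first exact: powR_ge0.
apply: (@le_trans _ _ (2 `^ a)).
  by rewrite ge0_ler_powR ?nnegrE//; lra.
by apply: ler_powR; [lra|rewrite lerDl].
Qed.

Lemma jacobi_opp a b x : jacobi a b (- x) = jacobi b a x.
Proof. by rewrite /jacobi opprK mulrC. Qed.

Lemma Wdelta_opp d a b x : Wdelta d a b (- x) = Wdelta d b a x.
Proof. by rewrite /Wdelta opprK phi_opp mulrC. Qed.

Lemma Wdelta_endpoint_le k a b h u : 0 <= a -> 0 <= b -> 0 < h -> near_end k 1 h u ->
  Wdelta (k%:R * h) a b (u - 1) <=
    2 `^ (a + b) * (u - k%:R * (h * psi u) / 2) `^ b.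
Proof.
move=> a0 b0 h0 [/andP[u0 u1] ub]; rewrite /Wdelta -/(psi u).
have kp : 0 <= k%:R * h * psi u / 2 by rewrite divr_ge0// !mulr_ge0 ?phi_ge0// ltW.
rewrite (_ : 1 + (u - 1) - k%:R * h * psi u / 2 = u - k%:R * (h * psi u) / 2); last by ring.
apply: ler_wpM2r; first exact: powR_ge0.
apply: (@le_trans _ _ (2 `^ a)).
  by rewrite ge0_ler_powR ?nnegrE//; lra.
by apply: ler_powR; [lra|rewrite lerDl].
Qed.

(** Here both [u] and [k * h * psi u / 2] are at most 1/2, so the base of the far factor is at least
    1. *)
Lemma Wdelta_endpoint_ge k a b h u : 0 <= a -> near_end k 2^-1 h u ->
  (u - k%:R * (h * psi u) / 2) `^ b <= Wdelta (k%:R * h) a b (u - 1).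
Proof.
move=> a0 [/andP[u0 u1] ub]; rewrite /Wdelta -/(psi u).
rewrite (_ : 1 + (u - 1) - k%:R * h * psi u / 2 = u - k%:R * (h * psi u) / 2); last by ring.
by rewrite ler_peMl ?powR_ge0// powR_ge1//; lra.
Qed.

Lemma Wdelta_le_jacobi d a b x : 0 <= a -> 0 <= b -> 0 <= d -> Ddelta d x ->
  Wdelta d a b x <= jacobi a b x.
Proof.
move=> a0 b0 d0 /(DdeltaP d0)[x1 dx _].
have dp : 0 <= d * phi x / 2 by rewrite divr_ge0// mulr_ge0 ?phi_ge0.
have xl : x <= `|x| := ler_norm x.
have xl' : - x <= `|x| by rewrite -normrN ler_norm.
by apply: ler_pM; rewrite ?powR_ge0// ge0_ler_powR ?nnegrE//; lra.
Qed.

(** Subtracting [d * phi x / 2] removes at most half of [1 - x] and of [1 + x]. *)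
Lemma jacobi_le_Wdelta d a b x : 0 <= a -> 0 <= b -> 0 <= d ->
  d * phi x / 2 <= (1 - `|x|) / 2 -> `|x| <= 1 ->
  jacobi a b x <= 2 `^ (a + b) * Wdelta d a b x.
Proof.
move=> a0 b0 d0 dx x1.
have dp : 0 <= d * phi x / 2 by rewrite divr_ge0// mulr_ge0 ?phi_ge0.
have xl : x <= `|x| := ler_norm x.
have xl' : - x <= `|x| by rewrite -normrN ler_norm.
rewrite /jacobi /Wdelta powRD ?pnatr_eq0 ?implybT//.
rewrite mulrACA -!powRM//; [|lra|lra].
by apply: ler_pM; rewrite ?powR_ge0// ge0_ler_powR ?nnegrE//; lra.
Qed.

(** After squaring and dividing by [1 - |x|] it remains that [(k * h) ^ 2 * (1 + |x|) <= 1 - |x|];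
    the left side is at most [2 * k ^ 2 * t ^ 2]. *)
Lemma middle_step_le k (t h x : R) : 0 < h -> h <= t ->
  `|x| <= 1 - 2 * k%:R ^+ 2 * t ^+ 2 -> k%:R * h * phi x / 2 <= (1 - `|x|) / 2.
Proof.
move=> h0 ht xT; set d := k%:R * h.
have d0 : 0 <= d by rewrite mulr_ge0// ltW.
have dt : d ^+ 2 <= k%:R ^+ 2 * t ^+ 2.
  by rewrite -exprMn lerXn2r ?nnegrE ?mulr_ge0// ?ler_wpM2l// ?ltW// (lt_le_trans h0).
have x1 : `|x| <= 1 by nra.
have n0 : 0 <= `|x| by [].
rewrite ler_pM2r// -(@ler_pXn2r _ 2)// ?nnegrE ?mulr_ge0 ?phi_ge0 ?subr_ge0//.
  rewrite exprMn phi_sqr// -[x ^+ 2]real_normK ?num_real//.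
  rewrite (_ : d ^+ 2 * _ = (d ^+ 2 * (1 + `|x|)) * (1 - `|x|)); last by ring.
  rewrite [leRHS]expr2; apply: ler_wpM2r; first by rewrite subr_ge0.
  have d2 : 0 <= d ^+ 2 by exact: sqr_ge0.
  nra.
exact: ltW.
Qed.

Lemma middle_Ddelta k (t h x : R) : (0 < k)%N -> 0 < h -> h <= t ->
  `|x| <= 1 - 2 * k%:R ^+ 2 * t ^+ 2 -> Ddelta (k%:R * h) x.
Proof.
move=> k0 h0 ht xT; have H := middle_step_le h0 ht xT.
have kt : 0 < 2 * k%:R ^+ 2 * t ^+ 2 :> R.
  by rewrite !mulr_gt0 ?exprn_gt0 ?ltr0n// (lt_le_trans h0).
have x1 : `|x| < 1 by lra.
split=> /=; first by lra.
by move: x1; rewrite ltr_norml => /andP[? ?] [] ?; lra.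
Qed.

End Weights.

(** * Replacing the derivative by a Borel function inside norms of differences *)

Section DifferencesLp.
Variable R : realType.
Local Notation mu := (@lebesgue_measure R).
Implicit Types (f g : R -> R) (k : nat) (x h : R).

Lemma Delta_fd k h f x : -1 <= x - k%:R * h / 2 -> x + k%:R * h / 2 <= 1 ->
  Delta k h f x = fd k h f (x - k%:R * h / 2).
Proof.
move=> l1 l2; rewrite /Delta asboolT// => y /=; rewrite !in_itv/= => /andP[y1 y2].
by rewrite (le_trans l1 y1) (le_trans y2 l2).
Qed.

(** The two integrands can differ only on [N] and where some node falls into [N]; each of the
    [k + 1] node maps expands, so these sets are null. *)
Lemma LpI_fd_eq p (I N : set R) (F w w' s z g g' : R -> R) k : (1 <= p)%E ->
  measurable I -> measurable N -> mu N = 0 ->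
  measurable_fun setT w' -> measurable_fun setT s -> measurable_fun setT z ->
  measurable_fun setT g' ->
  (forall x, I x -> ~ N x -> w x = w' x) ->
  (forall y, -1 <= y <= 1 -> ~ N y -> g y = g' y) ->
  (forall i, (i <= k)%N -> expanding 2^-1 I (fun x => z x + i%:R * s x)) ->
  (forall i x, (i <= k)%N -> I x -> -1 <= z x + i%:R * s x <= 1) ->
  (forall x, I x -> F x = w x * fd k (s x) g (z x)) ->
  LpI p I F = LpI p I (fun x => w' x * fd k (s x) g' (z x)).
Proof.
move=> p1 mI mN N0 mw' ms mz mg' ww' gg' ex node FE.
pose nd (i : nat) x := z x + i%:R * s x.
have mnd i : measurable_fun setT (nd i) by apply: measurable_funD => //; exact: measurable_funM.
pose B (i : nat) := if (i <= k)%N then I `&` nd i @^-1` N else set0.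
have mB i : measurable (B i).
  rewrite /B; case: ifP => // _; apply: measurableI => //.
  by rewrite -[_ @^-1` _]setTI; exact: mnd.
have muB i : mu (B i) = 0.
  rewrite /B; case: ifPn => [ik|_]; last exact: measure0.
  have := lebesgue_measure_expanding_preimage (_ : 0 < 2^-1) mI (mnd i) (ex i ik) mN.
  rewrite N0 mule0 => H; apply/eqP; rewrite eq_le measure_ge0 andbT; apply: H.
  by rewrite invr_gt0.
have mUB : measurable (\bigcup_i B i) by apply: bigcupT_measurable.
have muUB : mu (\bigcup_i B i) = 0.
  apply/eqP; rewrite eq_le measure_ge0 andbT.
  have := @measure_sigma_subadditive _ _ _ mu _ _ mB mUB (subset_refl _).
  by rewrite eseries0 => [|i _ _]; [exact|exact: muB].
apply: (LpI_ae_eq p1 mI (measurableU _ _ mN mUB)) => //.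
- by rewrite measureU0.

- apply: measurable_funM => //.
  have mpair : measurable_fun setT (fun x => (s x, z x)) by exact: measurable_fun_pair.
  exact: (measurableT_comp (measurable_fd2 k mg') mpair).
move=> x Ix nNB; rewrite FE// ww'//; last by move=> Nx; apply: nNB; left.
congr (_ * _); rewrite /fd; apply: eq_big_nat => i /andP[_ ik].
rewrite gg'//; first exact: node.
move=> Ni; apply: nNB; right; exists i => //.
by rewrite /B -ltnS ik.
Qed.

(** Membership makes [phi ^ r * f^(r)] Lebesgue measurable; a Borel version of this product is
    divided by [phi ^ r]. The points [-1] and [1], where [phi] vanishes, are put into [N]. *)
Lemma Brp_borel_representative (r : nat) p (w f : R -> R) : Brp r p w f ->
  exists N (g : R -> R), [/\ measurable N, mu N = 0, measurable_fun setT g,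
    N (-1) /\ N 1 & forall y, -1 <= y <= 1 -> ~ N y -> derive1n r f y = g y].
Proof.
move=> Bf; pose I : set R := `[-1, 1]%classic.
have mI : measurable I by exact: measurable_itv.
have mphi : measurable_fun (I : set (lebesgueR R))
    ((fun x => phi x ^+ r * derive1n r f x) : lebesgueR R -> R).
  case: r Bf => [|s] /=; last by case=> _ _ [].
  by move=> -[mf _]; under eq_fun do rewrite expr0 mul1r.
have [N [mN N0 mF]] := borel_representative mI mphi.
pose F := (fun x => phi x ^+ r * derive1n r f x) \_ (I `\` N).
exists (N `|` [set -1; 1]), (fun x => F x * phi x `^ (- r%:R)).
have m2 : measurable ([set -1; 1] : set R).
  by apply: measurableU; exact: measurable_set1.
split.
- exact: measurableU.
- rewrite measureU0//.
  by rewrite measureU0//; exact: lebesgue_measure_set1.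
- apply: measurable_funM; first exact: mF.
  by apply: (measurableT_comp (measurable_powR _)); exact: measurable_phi.
- by split; right; [left|right].
move=> y /andP[y1 y2] nN.
have ylt : `|y| < 1.
  rewrite ltr_norml !lt_neqAle y1 y2 !andbT; apply/andP; split; apply/negP => /eqP E; apply: nN.
    by right; left.
  by right; right.
have p0 := phi_gt0 ylt.
rewrite /F patchE mem_set; last first.
  by split; [rewrite /I/= in_itv/= y1|move=> Ny; apply: nN; left].
rewrite powRN powR_mulrn ?phi_ge0// mulrAC divff ?mul1r//.
by rewrite expf_neq0// gt_eqF.
Qed.

End DifferencesLp.

Lemma ge0_integral_setU_le (R : realType) (A B : set R) (F : R -> \bar R) :
  measurable A -> measurable B -> measurable_fun setT F -> (forall x, 0 <= F x)%E ->
  (\int[lebesgue_measure]_(x in A `|` B) F x <=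
   \int[lebesgue_measure]_(x in A) F x + \int[lebesgue_measure]_(x in B) F x)%E.
Proof.
move=> mA mB mF F0; have -> : A `|` B = A `|` (B `\` A).
  by apply/seteqP; split=> x /=; [have [] := pselect (A x); tauto|tauto].
have mBA : measurable (B `\` A) by exact: measurableD.
rewrite ge0_integral_setU//; last 2 first.
- exact: measurable_funTS.
- by rewrite disj_set2E; apply/eqP/seteqP; split=> x //= [Ax []].
by apply: leeD => //; apply: ge0_subset_integral => //; exact: measurable_funTS.
Qed.

(** * Comparison of the two moduli *)

Section JacobiComparison.
Variables (R : realType) (k : nat) (a b t : R) (g : R -> R).
Local Notation mu := (@lebesgue_measure R).
Hypotheses (k0 : (0 < k)%N) (a0 : 0 <= a) (b0 : 0 <= b) (mg : measurable_fun setT g).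
Let T := 2 * k%:R ^+ 2 * t ^+ 2.
Hypotheses (t0 : 0 < t) (T12 : 12 * T <= 1) (tE : end_const R k * t ^+ 2 <= 2^-1).
Implicit Types (Phi : R -> \bar R) (M : \bar R) (h s x : R).

Let w := jacobi a b.
Let W h := Wdelta (k%:R * h) a b.
Let c : R := 2 `^ (a + b).
Let mid : set R := `[-1 + T, 1 - T]%classic.
Let lft : set R := `[-1, -1 + 12 * T]%classic.
Let rgt : set R := `[1 - 12 * T, 1]%classic.

Let mw : measurable_fun setT w. Proof. exact: measurable_jacobi. Qed.
Let mW h : measurable_fun setT (W h). Proof. exact: measurable_Wdelta. Qed.
Let w0 x : 0 <= w x. Proof. exact: jacobi_ge0. Qed.
Let W0 h x : 0 <= W h x. Proof. exact: Wdelta_ge0. Qed.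
Let c1 : 1 <= c. Proof. by apply: powR_ge1; [lra|exact: addr_ge0]. Qed.
Let cC : 2 `^ (b + a) = c. Proof. by rewrite addrC. Qed.
Let T0 : 0 < T.
Proof. by apply: mulr_gt0; [apply: mulr_gt0|]; rewrite ?exprn_gt0 ?ltr0n. Qed.

Let mid_abs x : mid x -> `|x| <= 1 - T.
Proof.
by rewrite /mid/= in_itv/= ler_norml => /andP[? ?]; apply/andP; split; lra.
Qed.

Let wl u : 0 <= u <= 1 -> u `^ b <= w (1 * (u - 1)) /\ w (1 * (u - 1)) <= c * u `^ b.
Proof. by rewrite mul1r; exact: jacobi_endpoint. Qed.
Let wr u : 0 <= u <= 1 -> u `^ a <= w (-1 * (u - 1)) /\ w (-1 * (u - 1)) <= c * u `^ a.
Proof. by rewrite mulN1r /w jacobi_opp -cC; exact: jacobi_endpoint. Qed.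

Lemma fd_left s x : fd k s (fun u : R => g (1 * (u - 1))) (1 + 1 * x) = fd k s g x.
Proof. by apply: eq_bigr => i _; congr (_ * g _); ring. Qed.

Lemma norm_fd_right s x :
  `|fd k s (fun u : R => g (-1 * (u - 1))) (1 + -1 * x)| = `|fd k s g (x - k%:R * s)|.
Proof.
rewrite (_ : (fun u : R => _) = fun u => g (1 - u)); last first.
  by apply/funext => u; congr g; ring.
rewrite fd_reflect normrM normrX normrN1 expr1n mul1r.
by congr `|fd k s g _|; ring.
Qed.

Let lftE : endset 1 (12 * T) = lft.
Proof.
by apply/seteqP; split=> x; rewrite /endset /lft/= in_itv/= mul1r => /andP[? ?];
  apply/andP; split; lra.
Qed.
Let rgtE : endset (-1) (12 * T) = rgt.
Proof.
by apply/seteqP; split=> x; rewrite /endset /rgt/= in_itv/= mulN1r => /andP[? ?];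
  apply/andP; split; lra.
Qed.

(** The domain is covered by the middle interval, contributing 1 to the constant, and two end
    pieces, contributing [8 * k ^ 2 * (k + 1)] each. *)
Lemma gauge_cdiff_le Phi M : gauge Phi ->
  (forall h, 0 < h -> h <= t ->
     (\int[mu]_(x in mid) Phi (w x * `|cdiff k g h x|)%R <= M)%E) ->
  (forall s, 0 < s -> s <= T -> (\int[mu]_(x in lft) Phi (w x * `|fd k s g x|)%R <= M)%E) ->
  (forall s, 0 < s -> s <= T ->
     (\int[mu]_(x in rgt) Phi (w x * `|fd k s g (x - k%:R * s)|)%R <= M)%E) ->
  forall h, 0 < h -> h <= t ->
  (\int[mu]_(x in Ddelta (k%:R * h))
     Phi (W h x * `|cdiff k g h x| / (c * 2 ^+ k.+1 * 2 ^+ k))%R <=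
   (1 + 2 * (8 * k%:R ^+ 2 * k.+1%:R))%:E * M)%E.
Proof.
move=> gP Hm Hl Hr h h0 ht; have [mPhi P0 Pm] := gP.
have M0 : (0 <= M)%E.
  by apply: le_trans (Hm h h0 ht); apply: integral_ge0 => x _; exact: P0.
have kh0 : 0 <= k%:R * h by rewrite mulr_ge0// ltW.
have c0 : 0 < c by rewrite (lt_le_trans ltr01).
pose K := c * 2 ^+ k.+1 * 2 ^+ k.
have K1 : 1 <= K by rewrite !mulr_ege1// exprn_ege1// ler1n.
have K0 : 0 < K by rewrite (lt_le_trans ltr01).
pose NL := [set x | near_end k T h (1 + 1 * x)].
pose NR := [set x | near_end k T h (1 + -1 * x)].
have mN e : measurable [set x | near_end k T h (1 + e * x)].
  have m1 : measurable_fun setT (fun x : R => 1 + e * x).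
    by apply: measurable_funD => //; exact: measurable_funM.
  by rewrite -[X in measurable X]setTI; apply: m1 => //; exact: measurable_near_end.
have mcd := @measurable_cdiff R k g mg h.
have mF : measurable_fun setT (fun x => Phi (W h x * `|cdiff k g h x| / K)).
  apply: (measurableT_comp mPhi); apply: measurable_funM => //.
  by apply: measurable_funM => //; exact: measurableT_comp.
have cover x : Ddelta (k%:R * h) x -> (mid `|` (NL `|` NR)) x.
  move=> /(DdeltaP kh0)[x1 dx _]; move: (x1); rewrite ltr_norml => /andP[xl xr].
  have [xT|xT] := ltP x (-1 + T).
    right; left; rewrite /NL /near_end/= mul1r /psi (_ : 1 + x - 1 = x); last by ring.
    have x0 : x < 0 by move: T12; clearbody T; lra.
    rewrite (ltr0_norm x0) in dx.
    by split; [apply/andP; split; lra|lra].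
  have [xT'|xT'] := ltP (1 - T) x.
    right; right; rewrite /NR /near_end/= mulN1r /psi (_ : 1 - x - 1 = - x); last by ring.
    have x0 : 0 < x by move: T12; clearbody T; lra.
    rewrite phi_opp; rewrite (gtr0_norm x0) in dx.
    by split; [apply/andP; split; lra|lra].
  by left; rewrite /mid/= in_itv/= xT xT'.
have mmid : measurable mid by exact: measurable_itv.
apply: (@le_trans _ _ (\int[mu]_(x in mid `|` (NL `|` NR)) Phi (W h x * `|cdiff k g h x| / K)%R)%E).
  apply: ge0_subset_integral => //.
  - exact: measurable_Ddelta.
  - by apply: measurableU => //; apply: measurableU; exact: mN.
  - exact: measurable_funTS.
have mNL : measurable NL by exact: mN.
have mNR : measurable NR by exact: mN.
have F0 x : (0 <= Phi (W h x * `|cdiff k g h x| / K)%R)%E by exact: P0.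
apply: (le_trans (ge0_integral_setU_le mmid (measurableU _ _ mNL mNR) mF F0)).
rewrite (_ : 1 + 2 * _ = 1 + (8 * k%:R ^+ 2 * k.+1%:R + 8 * k%:R ^+ 2 * k.+1%:R)); last by ring.
have C0 : 0 <= 8 * k%:R ^+ 2 * k.+1%:R :> R by rewrite !mulr_ge0 ?sqr_ge0.
rewrite EFinD ge0_muleDl ?lee_fin ?addr_ge0// mul1e; apply: leeD.
  apply: (le_trans _ (Hm h h0 ht)); apply: ge0_le_integral => //.
  - exact: measurable_funTS.
  - apply: measurable_funTS; apply: (measurableT_comp mPhi); apply: measurable_funM => //.
    exact: measurableT_comp.
  move=> x /mid_abs xT.
  have Dx : Ddelta (k%:R * h) x by exact: (middle_Ddelta k0 h0 ht xT).
  rewrite -/K; apply: Pm; first by apply: divr_ge0; [exact: mulr_ge0|exact: ltW].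
  (* In the middle [W <= w], and the scale [K >= 1] shared with the end pieces does no harm. *)
  rewrite ler_pdivrMr//; apply: (@le_trans _ _ (w x * `|cdiff k g h x|)).
    by apply: ler_wpM2r => //; exact: Wdelta_le_jacobi.
  by rewrite ler_peMr// mulr_ge0.
apply: (le_trans (ge0_integral_setU_le mNL mNR mF F0)).
rewrite EFinD ge0_muleDl ?lee_fin//; apply: leeD.
- apply: (near_endpoint_cdiff_le k0 mg mw mW W0 (or_introl erefl) b0 c1 wl) => //.
  + by move=> h' u h'0 nu; rewrite mul1r; exact: Wdelta_endpoint_le.
  + by move=> s s0 sT; rewrite lftE; under eq_integral do rewrite fd_left; exact: Hl.
- apply: (near_endpoint_cdiff_le k0 mg mw mW W0 (or_intror erefl) a0 c1 wr) => //.
  + by move=> h' u h'0 nu; rewrite mulN1r /W Wdelta_opp -cC; exact: Wdelta_endpoint_le.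
  + by move=> s s0 sT; rewrite rgtE; under eq_integral do rewrite norm_fd_right; exact: Hr.
Qed.

Let Cend := k.+1%:R ^+ (8 * k) * (8 * k%:R * (1 + 2 * end_const R k)).
Let Kend := c * 2 ^+ (k * (8 * k)) * 2 ^+ k.+1.

Lemma gauge_left_le Phi M : gauge Phi ->
  (forall h, 0 < h -> h <= t ->
    (\int[mu]_(x in Ddelta (k%:R * h)) Phi (W h x * `|cdiff k g h x|)%R <= M)%E) ->
  forall s, 0 < s -> s <= T ->
  (\int[mu]_(x in lft) Phi (w x * `|fd k s g x| / Kend)%R <= Cend%:E * M)%E.
Proof.
move=> gP H s s0 sT; have [_ P0 _] := gP.
have M0 : (0 <= M)%E.
  by apply: le_trans (H t t0 (lexx _)); apply: integral_ge0 => x _; exact: P0.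
have vW h u : 0 < h -> near_end k 2^-1 h u ->
    (u - k%:R * (h * psi u) / 2) `^ b <= W h (1 * (u - 1)).
  by move=> h0 nu; rewrite mul1r; exact: Wdelta_endpoint_ge.
have := near_endpoint_fd_le k0 mg mw mW w0 (or_introl erefl) b0 c1 wl vW gP M0 T12 t0 tE H s0 sT.
by rewrite lftE; under eq_integral do rewrite fd_left.
Qed.

Lemma gauge_right_le Phi M : gauge Phi ->
  (forall h, 0 < h -> h <= t ->
    (\int[mu]_(x in Ddelta (k%:R * h)) Phi (W h x * `|cdiff k g h x|)%R <= M)%E) ->
  forall s, 0 < s -> s <= T ->
  (\int[mu]_(x in rgt) Phi (w x * `|fd k s g (x - k%:R * s)| / Kend)%R <= Cend%:E * M)%E.
Proof.
move=> gP H s s0 sT; have [_ P0 _] := gP.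
have M0 : (0 <= M)%E.
  by apply: le_trans (H t t0 (lexx _)); apply: integral_ge0 => x _; exact: P0.
have vW h u : 0 < h -> near_end k 2^-1 h u ->
    (u - k%:R * (h * psi u) / 2) `^ a <= W h (-1 * (u - 1)).
  by move=> h0 nu; rewrite mulN1r /W Wdelta_opp; exact: Wdelta_endpoint_ge.
have := near_endpoint_fd_le k0 mg mw mW w0 (or_intror erefl) a0 c1 wr vW gP M0 T12 t0 tE H s0 sT.
by rewrite rgtE; under eq_integral do rewrite norm_fd_right.
Qed.

(** The middle interval lies in [Ddelta (k * h)], and there [w <= c * W]. *)
Lemma gauge_middle_le Phi M : gauge Phi ->
  (forall h, 0 < h -> h <= t ->
    (\int[mu]_(x in Ddelta (k%:R * h)) Phi (W h x * `|cdiff k g h x|)%R <= M)%E) ->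
  forall h, 0 < h -> h <= t ->
  (\int[mu]_(x in mid) Phi (w x * `|cdiff k g h x| / c)%R <= M)%E.
Proof.
move=> gP H h h0 ht; have [mPhi P0 Pm] := gP; apply: le_trans (H h h0 ht).
have c0 : 0 < c by rewrite (lt_le_trans ltr01).
have mcd := @measurable_cdiff R k g mg h.
have mmid : measurable mid by exact: measurable_itv.
have mF : measurable_fun setT (fun x => Phi (W h x * `|cdiff k g h x|)).
  by apply: (measurableT_comp mPhi); apply: measurable_funM => //; exact: measurableT_comp.
apply: (@le_trans _ _ (\int[mu]_(x in mid) Phi (W h x * `|cdiff k g h x|)%R)%E).
  apply: ge0_le_integral => //.
  - apply: measurable_funTS; apply: (measurableT_comp mPhi); apply: measurable_funM => //.
    by apply: measurable_funM => //; exact: measurableT_comp.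
  - exact: measurable_funTS.
  move=> x /mid_abs xT; apply: Pm; first by apply: divr_ge0; [exact: mulr_ge0|exact: ltW].
  rewrite ler_pdivrMr// [leRHS]mulrAC; apply: ler_wpM2r => //; rewrite [leRHS]mulrC.
  apply: jacobi_le_Wdelta => //; first by rewrite mulr_ge0// ltW.
    exact: middle_step_le h0 ht xT.
  by apply: (le_trans xT); rewrite gerBl ltW.
apply: ge0_subset_integral => //.
- exact: measurable_Ddelta.
- exact: measurable_funTS.
- by move=> x /mid_abs; exact: middle_Ddelta.
Qed.

End JacobiComparison.

(** * The comparison in Lp norm, in both directions *)

Section LpComparison.
Variables (R : realType) (k : nat) (a b t : R) (p : \bar R) (g : R -> R).
Hypotheses (k0 : (0 < k)%N) (p1 : (1 <= p)%E) (a0 : 0 <= a) (b0 : 0 <= b).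
Hypotheses (mg : measurable_fun setT g) (t0 : 0 < t).
Let T := 2 * k%:R ^+ 2 * t ^+ 2.
Hypotheses (T12 : 12 * T <= 1) (tE : end_const R k * t ^+ 2 <= 2^-1).

Let w := jacobi a b.
Let W h := Wdelta (k%:R * h) a b.
Let c : R := 2 `^ (a + b).
Let mid : set R := `[-1 + T, 1 - T]%classic.
Let lft : set R := `[-1, -1 + 12 * T]%classic.
Let rgt : set R := `[1 - 12 * T, 1]%classic.
Let mw : measurable_fun setT w. Proof. exact: measurable_jacobi. Qed.
Let mW h : measurable_fun setT (W h). Proof. exact: measurable_Wdelta. Qed.
Let w0 x : 0 <= w x. Proof. exact: jacobi_ge0. Qed.
Let W0 h x : 0 <= W h x. Proof. exact: Wdelta_ge0. Qed.
Let c1 : 1 <= c. Proof. by apply: powR_ge1; [lra|exact: addr_ge0]. Qed.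
Let c0 : 0 < c. Proof. by rewrite (lt_le_trans ltr01). Qed.
Let mmid : measurable mid. Proof. exact: measurable_itv. Qed.
Let mlft : measurable lft. Proof. exact: measurable_itv. Qed.
Let mrgt : measurable rgt. Proof. exact: measurable_itv. Qed.
Let mcd h : measurable_fun setT (cdiff k g h). Proof. exact: measurable_cdiff. Qed.
Let mfr s : measurable_fun setT (fun x : R => fd k s g (x - k%:R * s)).
Proof.
have mz : measurable_fun setT (fun x : R => x - k%:R * s) by exact: measurable_funB.
exact: (measurableT_comp (measurable_fd k s mg) mz).
Qed.

Let norm_wM (v y : R) : 0 <= v -> `|v * y| = v * `|y|.
Proof. by move=> v0; rewrite normrM ger0_norm. Qed.

Lemma LpI_cdiff_le (m l r : \bar R) : (0 <= m)%E -> (0 <= l)%E -> (0 <= r)%E ->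
  (forall h : R, 0 < h -> h <= t -> (LpI p mid (fun x => w x * cdiff k g h x)%R <= m)%E) ->
  (forall s : R, 0 < s -> s <= T -> (LpI p lft (fun x => w x * fd k s g x)%R <= l)%E) ->
  (forall s : R, 0 < s -> s <= T ->
    (LpI p rgt (fun x => w x * fd k s g (x - k%:R * s))%R <= r)%E) ->
  forall h : R, 0 < h -> h <= t ->
  (LpI p (Ddelta (k%:R * h)%R) (fun x => W h x * cdiff k g h x)%R <=
   (c * 2 ^+ k.+1 * 2 ^+ k * (1 + 2 * (8 * k%:R ^+ 2 * k.+1%:R)))%:E * (m + l + r))%E.
Proof.
move=> m0 l0 r0 Hm Hl Hr h h0 ht.
pose Jt := {h : R | 0 < h /\ h <= t}; pose JT := {s : R | 0 < s /\ s <= T}.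
(* The three families of norms are merged into a single one, with common bound [m + l + r]. *)
pose Ij (j : Jt + (JT + JT)) : set R :=
  match j with inl _ => mid | inr (inl _) => lft | inr (inr _) => rgt end.
pose fj (j : Jt + (JT + JT)) : R -> R := match j with
  | inl h => fun x => w x * cdiff k g (sval h) x
  | inr (inl s) => fun x => w x * fd k (sval s) g x
  | inr (inr s) => fun x => w x * fd k (sval s) g (x - k%:R * sval s) end.
have C1 : 1 <= 1 + 2 * (8 * k%:R ^+ 2 * k.+1%:R) :> R.
  by rewrite lerDl !mulr_ge0 ?sqr_ge0.
apply: (@LpI_le_of_gauge_scaled _ _ _ _ _ _ _ Ij fj) => //.
- by rewrite !mulr_gt0 ?exprn_gt0.
- by rewrite !adde_ge0.
- exact: measurable_Ddelta.
- exact: measurable_funM.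
- by move=> [?|[?|?]].
- by move=> [?|[?|?]]; apply: measurable_funM => //; exact: measurable_fd.
- move=> Phi M gP H; under eq_integral do rewrite norm_wM//.
  apply: (gauge_cdiff_le k0 a0 b0 mg T12 gP) => //.
  + move=> h' h'0 h't; have := H (inl (exist _ h' (conj h'0 h't))).
    by under eq_integral do rewrite /= norm_wM//.
  + move=> s s0 sT; have := H (inr (inl (exist _ s (conj s0 sT)))).
    by under eq_integral do rewrite /= norm_wM//.
  + move=> s s0 sT; have := H (inr (inr (exist _ s (conj s0 sT)))).
    by under eq_integral do rewrite /= norm_wM//.
move=> [[h' [h'0 h't]]|[[s [s0 sT]]|[s [s0 sT]]]] /=.
- by apply: (le_trans (Hm h' h'0 h't)); rewrite -addeA leeDl// adde_ge0.
- by apply: (le_trans (Hl s s0 sT)); rewrite addeAC leeDr// adde_ge0.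
- by apply: (le_trans (Hr s s0 sT)); rewrite leeDr// adde_ge0.
Qed.

Section Converse.
Variable B : \bar R.
Hypotheses (B0 : (0 <= B)%E) (HB : forall h : R, 0 < h -> h <= t ->
  (LpI p (Ddelta (k%:R * h)%R) (fun x => W h x * cdiff k g h x)%R <= B)%E).
Let Cend := k.+1%:R ^+ (8 * k) * (8 * k%:R * (1 + 2 * end_const R k)).
Let Kend := c * 2 ^+ (k * (8 * k)) * 2 ^+ k.+1.
Let Jt := {h : R | 0 < h /\ h <= t}.
Let Ij (j : Jt) : set R := Ddelta (k%:R * sval j).
Let fj (j : Jt) : R -> R := fun x => W (sval j) x * cdiff k g (sval j) x.
Let mIj j : measurable (Ij j). Proof. exact: measurable_Ddelta. Qed.
Let mfj j : measurable_fun setT (fj j). Proof. exact: measurable_funM. Qed.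
Let HBj j : (LpI p (Ij j) (fj j) <= B)%E.
Proof. by case: j => h [h0 ht]; exact: HB. Qed.

Let Hgauge Phi M : gauge Phi ->
  (forall j, \int[lebesgue_measure]_(x in Ij j) Phi (`|fj j x|)%R <= M)%E ->
  forall h : R, 0 < h -> h <= t ->
  (\int[lebesgue_measure]_(x in Ddelta (k%:R * h)%R) Phi (W h x * `|cdiff k g h x|)%R <= M)%E.
Proof.
move=> gP H h h0 ht; have := H (exist _ h (conj h0 ht)).
by under eq_integral do rewrite norm_wM//.
Qed.

Let end_const_gt0 : 0 < end_const R k.
Proof. by rewrite /end_const !addr_gt0// ?divr_gt0// ?mulr_gt0// ?exprn_gt0// ltr0n. Qed.
Let Cend1 : 1 <= Cend.
Proof.
rewrite /Cend mulr_ege1// ?exprn_ege1// ?ler1n// mulr_ege1//.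
  by rewrite -natrM ler1n muln_gt0.
by rewrite lerDl mulr_ge0// ltW.
Qed.
Let Kend0 : 0 < Kend. Proof. by rewrite !mulr_gt0 ?exprn_gt0. Qed.

Lemma LpI_left_le s : 0 < s -> s <= T ->
  (LpI p lft (fun x => w x * fd k s g x)%R <= (Kend * Cend)%:E * B)%E.
Proof.
move=> s0 sT; apply: (LpI_le_of_gauge_scaled p1 Cend1 Kend0 B0 mlft _ mIj mfj _ HBj).
  by apply: measurable_funM => //; exact: measurable_fd.
move=> Phi M gP /(Hgauge gP) H; under eq_integral do rewrite norm_wM//.
exact: gauge_left_le.
Qed.

Lemma LpI_right_le s : 0 < s -> s <= T ->
  (LpI p rgt (fun x => w x * fd k s g (x - k%:R * s))%R <= (Kend * Cend)%:E * B)%E.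
Proof.
move=> s0 sT; apply: (LpI_le_of_gauge_scaled p1 Cend1 Kend0 B0 mrgt _ mIj mfj _ HBj).
  exact: measurable_funM.
move=> Phi M gP /(Hgauge gP) H; under eq_integral do rewrite norm_wM//.
exact: gauge_right_le.
Qed.

Lemma LpI_middle_le h : 0 < h -> h <= t ->
  (LpI p mid (fun x => w x * cdiff k g h x)%R <= c%:E * B)%E.
Proof.
move=> h0 ht; rewrite -[c]mulr1.
apply: (LpI_le_of_gauge_scaled p1 (lexx _) c0 B0 mmid _ mIj mfj _ HBj).
  exact: measurable_funM.
move=> Phi M gP /(Hgauge gP) H; under eq_integral do rewrite norm_wM//.
by rewrite mul1e; exact: gauge_middle_le.
Qed.

End Converse.
End LpComparison.

(** * Norms in the two moduli expressed through the Borel representative *)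

Section Representative.
Variables (R : realType) (k r : nat) (alpha beta t : R) (p : \bar R) (f g : R -> R).
Variable N : set R.
Hypotheses (k0 : (0 < k)%N) (p1 : (1 <= p)%E) (t0 : 0 < t).
Let T := 2 * k%:R ^+ 2 * t ^+ 2.
Hypotheses (T1 : (12 + k%:R) * T <= 1).
Hypotheses (mN : measurable N) (N0 : lebesgue_measure N = 0) (mg : measurable_fun setT g)
  (N1 : N (-1) /\ N 1) (fg : forall y, -1 <= y <= 1 -> ~ N y -> f y = g y).
Let a := r%:R / 2 + alpha.
Let b := r%:R / 2 + beta.

Let kR0 : 0 < k%:R :> R. Proof. by rewrite ltr0n. Qed.
Let T0 : 0 < T.
Proof. by apply: mulr_gt0; [apply: mulr_gt0|]; rewrite ?exprn_gt0 ?ltr0n. Qed.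
Let kT : k%:R * T <= 1 - 12 * T. Proof. by move: T1; rewrite mulrDl; lra. Qed.


Let weightE (x : R) : -1 <= x <= 1 -> ~ N x -> jacobi_phi alpha beta r x = jacobi a b x.
Proof.
move=> /andP[x1 x2] nN; apply: jacobi_phiE.
rewrite ltr_norml !lt_neqAle x1 x2 !andbT.
by apply/andP; split; apply/negP => /eqP E; apply: nN; [rewrite -E|rewrite E]; case: N1.
Qed.

Let mhp h : measurable_fun setT (fun x : R => h * phi x).
Proof. by apply: measurable_funM => //; exact: measurable_phi. Qed.
Let mstart h : measurable_fun setT (fun x : R => x - k%:R * (h * phi x) / 2).
Proof. by apply: measurable_funB => //; apply: measurable_funM => //; exact: measurable_funM. Qed.

Let expanding_center (h : R) (i : nat) (X : set R) : 0 < h -> X `<=` Ddelta (k%:R * h) ->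
  (i <= k)%N -> expanding 2^-1 X (fun x => x - k%:R * (h * phi x) / 2 + i%:R * (h * phi x)).
Proof.
move=> h0 XD ik x x' /XD Dx /XD Dx'.
have c2 : `|i%:R / k%:R - 2^-1| <= 2^-1 :> R.
  have i0 : 0 <= i%:R / k%:R :> R by rewrite divr_ge0.
  have i1 : i%:R / k%:R <= 1 :> R by rewrite ler_pdivrMr// mul1r ler_nat.
  by rewrite ler_norml; lra.
have kh0 : 0 <= k%:R * h by rewrite mulr_ge0// ltW.
have := expanding_node kh0 c2 Dx Dx'.
by congr (_ <= `|_ - _|); field; rewrite gt_eqF.
Qed.

Let node_center (h : R) (i : nat) (x : R) : 0 < h -> Ddelta (k%:R * h) x -> (i <= k)%N ->
  -1 <= x - k%:R * (h * phi x) / 2 + i%:R * (h * phi x) <= 1.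
Proof.
move=> h0 Dx ik.
have kh0 : 0 <= k%:R * h by rewrite mulr_ge0// ltW.
have [x1 dx _] := DdeltaP kh0 Dx.
have xl : x <= `|x| := ler_norm x.
have xl' : - x <= `|x| by rewrite -normrN ler_norm.
have hp : 0 <= h * phi x by rewrite mulr_ge0 ?phi_ge0// ltW.
have ih : 0 <= i%:R * (h * phi x) by rewrite mulr_ge0.
have ikh : i%:R * (h * phi x) <= k%:R * (h * phi x) by rewrite ler_wpM2r// ler_nat.
by rewrite -mulrA in dx; apply/andP; split; lra.
Qed.

Let Delta_center (h x : R) : 0 < h -> Ddelta (k%:R * h) x ->
  Delta k (h * phi x) f x = fd k (h * phi x) f (x - k%:R * (h * phi x) / 2).
Proof.
move=> h0 Dx; have := node_center h0 Dx (leq0n _); have := node_center h0 Dx (leqnn _).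
rewrite mul0r addr0 => /andP[_ l2] /andP[l1 _].
by apply: Delta_fd => //; lra.
Qed.

(** On [Ddelta (k * h)] all nodes lie in [-1, 1], so the domain test in [Delta] succeeds. *)
Lemma LpI_Delta_Ddelta (h : R) : 0 < h ->
  LpI p (Ddelta (k%:R * h)) (fun x => Wdelta (k%:R * h) a b x * Delta k (h * phi x) f x) =
  LpI p (Ddelta (k%:R * h)) (fun x => Wdelta (k%:R * h) a b x * cdiff k g h x).
Proof.
move=> h0; apply: (LpI_fd_eq (w := Wdelta (k%:R * h) a b) (N := N)
  (s := fun x => h * phi x) (z := fun x => x - k%:R * (h * phi x) / 2) (g := f)) => //.
- exact: measurable_Ddelta.
- exact: measurable_Wdelta.
- by move=> i ik; exact: expanding_center.
- by move=> i x ik Dx; exact: node_center.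
- by move=> x Dx; rewrite Delta_center.
Qed.

Lemma LpI_Delta_middle (h : R) : 0 < h -> h <= t ->
  LpI p `[-1 + T, 1 - T]%classic
    (fun x => jacobi_phi alpha beta r x * Delta k (h * phi x) f x) =
  LpI p `[-1 + T, 1 - T]%classic (fun x => jacobi a b x * cdiff k g h x).
Proof.
move=> h0 ht.
have mid_abs (x : R) : `[-1 + T, 1 - T]%classic x -> `|x| <= 1 - T.
  by rewrite /= in_itv/= ler_norml => /andP[? ?]; apply/andP; split; lra.
have midD : `[-1 + T, 1 - T]%classic `<=` Ddelta (k%:R * h).
  by move=> x /mid_abs; exact: middle_Ddelta.
have mid1 (x : R) : `[-1 + T, 1 - T]%classic x -> -1 <= x <= 1.
  by rewrite /= in_itv/= => /andP[? ?]; move: T0; clearbody T => ?; apply/andP; split; lra.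
apply: (LpI_fd_eq (w := jacobi_phi alpha beta r) (N := N)
  (s := fun x => h * phi x) (z := fun x => x - k%:R * (h * phi x) / 2) (g := f)) => //.
- exact: measurable_jacobi.
- by move=> x /mid1 x1; exact: weightE.
- by move=> i ik; exact: expanding_center.
- by move=> i x ik /midD Dx; exact: node_center.
- by move=> x /midD Dx; rewrite Delta_center.
Qed.

Let node_bound (s : R) (i : nat) : 0 < s -> s <= T -> (i <= k)%N ->
  0 <= i%:R * s /\ i%:R * s <= k%:R * T.
Proof.
by move=> s0 sT ik; split; [rewrite mulr_ge0// ltW|apply: ler_pM => //; rewrite ?ler_nat// ltW].
Qed.

Let expanding_shift (d : R) X : expanding 2^-1 X (fun x : R => x + d).
Proof.
move=> x x' _ _; rewrite (_ : x + d - (x' + d) = x - x'); last by ring.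
by rewrite ler_piMl// invf_le1// ler1n.
Qed.

(** The nodes go at most [k * T] beyond the base point, and [(12 + k) * T <= 1] keeps them in
    [-1, 1]. *)
Lemma LpI_fDelta_left (s : R) : 0 < s -> s <= T ->
  LpI p `[-1, -1 + 12 * T]%classic (fun x => jacobi_phi alpha beta r x * fDelta k s f x) =
  LpI p `[-1, -1 + 12 * T]%classic (fun x => jacobi a b x * fd k s g x).
Proof.
move=> s0 sT.
have node i x : (i <= k)%N -> `[-1, -1 + 12 * T]%classic x -> -1 <= x + i%:R * s <= 1.
  move=> ik; rewrite /= in_itv/= => /andP[x1 x2]; have [i0 i1] := node_bound s0 sT ik.
  by move: kT T0 i1 x2; clearbody T => *; apply/andP; split; lra.
apply: (LpI_fd_eq (w := jacobi_phi alpha beta r) (N := N) (s := cst s) (z := id) (g := f)) => //.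
- exact: measurable_jacobi.
- by move=> x Ix; have := node 0%N x (leq0n _) Ix; rewrite mul0r addr0 => x1; exact: weightE.
- by move=> i _; exact: (@expanding_shift (i%:R * s)).
move=> x Ix; have := node _ x (leq0n _) Ix; have := node _ x (leqnn _) Ix.
rewrite mul0r addr0 => /andP[_ l2] /andP[l1 _].
rewrite /fDelta Delta_fd; [|lra|lra].
by congr (_ * fd _ _ _ _); rewrite /= addrK.
Qed.

Lemma LpI_bDelta_right (s : R) : 0 < s -> s <= T ->
  LpI p `[1 - 12 * T, 1]%classic (fun x => jacobi_phi alpha beta r x * bDelta k s f x) =
  LpI p `[1 - 12 * T, 1]%classic (fun x => jacobi a b x * fd k s g (x - k%:R * s)).
Proof.
move=> s0 sT.
have node i x : (i <= k)%N -> `[1 - 12 * T, 1]%classic x ->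
    -1 <= x - k%:R * s + i%:R * s <= 1.
  move=> ik; rewrite /= in_itv/= => /andP[x1 x2]; have [i0 _] := node_bound s0 sT ik.
  have [_ i1] := node_bound s0 sT (leqnn _).
  have ii : i%:R * s <= k%:R * s by rewrite ler_pM2r// ler_nat.
  by move: kT T0 i1 x1; clearbody T => *; apply/andP; split; lra.
apply: (LpI_fd_eq (w := jacobi_phi alpha beta r) (N := N) (s := cst s)
  (z := fun x => x - k%:R * s) (g := f)) => //.
- exact: measurable_jacobi.
- exact: measurable_funB.
- by move=> x Ix; have := node _ x (leqnn _) Ix; rewrite subrK => x1; exact: weightE.
- move=> i ik x x' Ix Ix'.
  by have := expanding_shift (i%:R * s - k%:R * s) Ix Ix'; congr (_ <= `|_ - _|); rewrite /=; ring.
move=> x Ix; have := node _ x (leq0n _) Ix; have := node _ x (leqnn _) Ix.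
rewrite mul0r addr0 => /andP[_ l2] /andP[l1 _].
rewrite /bDelta Delta_fd; [|lra|lra].
by congr (_ * fd _ _ _ _); rewrite /=; field.
Qed.

End Representative.

(** * Choice of the constants and passage to suprema over the steps *)

Theorem theorem1p10 (R : realType) (k r : nat) (p : \bar R) (alpha beta : R)
    (hk : (0 < k)%N) (hp : (1 <= p)%E)
    (halpha : 0 <= r%:R / 2 + alpha) (hbeta : 0 <= r%:R / 2 + beta) :
  exists t0 : R, 0 < t0 /\
  exists c0 : R, 0 < c0 /\
  forall f : R -> R, Brp r p (jacobi alpha beta) f ->
  forall t : R, 0 < t -> t <= t0 ->
    ((c0^-1)%:E * omega_kr k r alpha beta p (derive1n r f) t
       <= omega_DT k (jacobi_phi alpha beta r) p (derive1n r f) t)%E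
    /\
    (omega_DT k (jacobi_phi alpha beta r) p (derive1n r f) t
       <= c0%:E * omega_kr k r alpha beta p (derive1n r f) t)%E.
Proof.
have kR0 : 0 < k%:R :> R by rewrite ltr0n.
have e0 : 0 < end_const R k.
  by rewrite /end_const !addr_gt0// ?divr_gt0// ?mulr_gt0// ?exprn_gt0.
(* From [t <= q^-1 <= 1] follows [q * t ^ 2 <= 1]; the summands of [q] then give [(12 + k) * T <= 1]
   and [end_const * t ^ 2 <= 1 / 2]. *)
pose q := 1 + (12 + k%:R) * (2 * k%:R ^+ 2) + 2 * end_const R k.
have kk0 : 0 <= (12 + k%:R) * (2 * k%:R ^+ 2) :> R by rewrite mulr_ge0// mulr_ge0// sqr_ge0.
have q1 : 1 <= q by rewrite /q; lra.
have q0 : 0 < q by rewrite (lt_le_trans ltr01).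
exists q^-1; split; first by rewrite invr_gt0.
pose c : R := 2 `^ (r%:R / 2 + alpha + (r%:R / 2 + beta)).
have cp : 0 < c by rewrite powR_gt0.
(* [A1] bounds [omega_kr] by [omega_DT]. Conversely the middle supremum costs [c] and each endpoint
   supremum [A2]; the sum of all four serves both directions. *)
pose A1 := c * 2 ^+ k.+1 * 2 ^+ k * (1 + 2 * (8 * k%:R ^+ 2 * k.+1%:R)).
pose A2 := c * 2 ^+ (k * (8 * k)) * 2 ^+ k.+1 *
  (k.+1%:R ^+ (8 * k) * (8 * k%:R * (1 + 2 * end_const R k))).
have A10 : 0 < A1.
  by rewrite /A1 !mulr_gt0 ?exprn_gt0// addr_gt0// !mulr_gt0 ?exprn_gt0// ltr0n.
have A20 : 0 < A2.
  by rewrite /A2 !mulr_gt0 ?exprn_gt0 ?ltr0n// addr_gt0// mulr_gt0.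
exists (A1 + (c + A2 + A2)); split; first by rewrite !addr_gt0.
move=> f Bf t t0 tq.
have [N [g [mN N0 mg N1 fg]]] := Brp_borel_representative Bf.
pose T := 2 * k%:R ^+ 2 * t ^+ 2.
have tt : t ^+ 2 <= q^-1.
  have t1 : t <= 1 by apply: (le_trans tq); rewrite invf_le1.
  by rewrite expr2; apply: (le_trans _ tq); rewrite ler_piMl// ltW.
have qt : q * t ^+ 2 <= 1 by rewrite -ler_pdivlMl// mulr1.
have t20 : 0 < t ^+ 2 by rewrite exprn_gt0.
have T1 : (12 + k%:R) * T <= 1.
  apply: le_trans qt; rewrite /T mulrA; apply: ler_wpM2r; first exact: ltW.
  by rewrite /q; lra.
have tE : end_const R k * t ^+ 2 <= 2^-1.
  have : 2 * end_const R k * t ^+ 2 <= 1.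
    apply: le_trans qt; apply: ler_wpM2r; first exact: ltW.
    by rewrite /q; lra.
  by lra.
have T0 : 0 < T by rewrite /T !mulr_gt0 ?exprn_gt0.
have T12 : 12 * T <= 1.
  by apply: le_trans T1; apply: ler_wpM2r; [exact: ltW|rewrite lerDl].
set F := derive1n r f in fg *.
rewrite /omega_kr /omega_DT -/T.
set Om := ereal_sup _; set Sm := ereal_sup _.
set Sl := ereal_sup _; set Sr := ereal_sup _.
have in_oc (x y : R) : 0 < x -> x <= y -> `]0, y]%classic x.
  by move=> x0 xy; rewrite /= in_itv/= x0.
have LpI0 I h : (0 <= LpI p I h)%E by exact: Lnorm_ge0.
have sup_ge0 (Q : R -> \bar R) y : 0 < y -> (forall x, 0 <= Q x)%E ->
    (0 <= ereal_sup [set Q h | h in `]0%R, y]])%E.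
  by move=> y0 Q0; apply: (le_trans (Q0 y)); apply: ereal_sup_ubound; exists y => //; exact: in_oc.
have Om0 : (0 <= Om)%E by exact: sup_ge0.
have Sm0 : (0 <= Sm)%E by exact: sup_ge0.
have Sl0 : (0 <= Sl)%E by exact: sup_ge0.
have Sr0 : (0 <= Sr)%E by exact: sup_ge0.
have HW h : 0 < h -> h <= t -> (LpI p (Ddelta (k%:R * h)%R) (fun x =>
    Wdelta (k%:R * h) (r%:R / 2 + alpha) (r%:R / 2 + beta) x * cdiff k g h x)%R <= Om)%E.
  move=> h0 ht; rewrite -(LpI_Delta_Ddelta r alpha beta hk hp mN N0 mg fg)//.
  by apply: ereal_sup_ubound; exists h => //; exact: in_oc.
have Hm h : 0 < h -> h <= t -> (LpI p `[-1 + T, 1 - T]%classic%R (fun x =>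
    jacobi (r%:R / 2 + alpha) (r%:R / 2 + beta) x * cdiff k g h x)%R <= Sm)%E.
  move=> h0 ht; rewrite -(LpI_Delta_middle r alpha beta hk hp t0 mN N0 mg N1 fg)//.
  by apply: ereal_sup_ubound; exists h => //; exact: in_oc.
have Hl s : 0 < s -> s <= T -> (LpI p `[-1, -1 + 12 * T]%classic%R (fun x =>
    jacobi (r%:R / 2 + alpha) (r%:R / 2 + beta) x * fd k s g x)%R <= Sl)%E.
  move=> s0 sT; rewrite -(LpI_fDelta_left r alpha beta hk hp t0 T1 mN N0 mg N1 fg)//.
  by apply: ereal_sup_ubound; exists s => //; exact: in_oc.
have Hr s : 0 < s -> s <= T -> (LpI p `[1 - 12 * T, 1]%classic%R (fun x =>
    jacobi (r%:R / 2 + alpha) (r%:R / 2 + beta) x * fd k s g (x - k%:R * s))%R <= Sr)%E.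
  move=> s0 sT; rewrite -(LpI_bDelta_right r alpha beta hk hp t0 T1 mN N0 mg N1 fg)//.
  by apply: ereal_sup_ubound; exists s => //; exact: in_oc.
have S0 : (0 <= Sm + Sl + Sr)%E by rewrite !adde_ge0.
split.
  rewrite lee_pdivrMl ?addr_gt0//.
  apply: ge_ereal_sup => y [h /=]; rewrite in_itv/= => /andP[h0 ht] <-.
  rewrite (LpI_Delta_Ddelta r alpha beta hk hp mN N0 mg fg)//.
  have := LpI_cdiff_le hk hp halpha hbeta mg T12 Sm0 Sl0 Sr0 Hm Hl Hr h0 ht.
  move=> /le_trans; apply; apply: lee_wpmul2r => //.
  by rewrite lee_fin lerDl ?addr_ge0// ltW.
have AE : ((A1 + (c + A2 + A2))%:E * Om =
    A1%:E * Om + (c%:E * Om + A2%:E * Om + A2%:E * Om))%E.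
  by rewrite !EFinD !ge0_muleDl ?lee_fin ?addr_ge0// ?ltW.
rewrite AE; apply: (@le_trans _ _ (c%:E * Om + A2%:E * Om + A2%:E * Om)%E); last first.
  by rewrite leeDr// mule_ge0// lee_fin ltW.
apply: leeD; [apply: leeD|].
- apply: ge_ereal_sup => y [h /=]; rewrite in_itv/= => /andP[h0 ht] <-.
  rewrite (LpI_Delta_middle r alpha beta hk hp t0 mN N0 mg N1 fg)//.
  exact: LpI_middle_le.
- apply: ge_ereal_sup => y [s /=]; rewrite in_itv/= => /andP[s0 sT] <-.
  rewrite (LpI_fDelta_left r alpha beta hk hp t0 T1 mN N0 mg N1 fg)//.
  exact: LpI_left_le.
- apply: ge_ereal_sup => y [s /=]; rewrite in_itv/= => /andP[s0 sT] <-.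
  rewrite (LpI_bDelta_right r alpha beta hk hp t0 T1 mN N0 mg N1 fg)//.
  exact: LpI_right_le.
Qed.
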